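(* The untwisted monomial spheres coming from the basic reflection groups $\mathbb Z_2^N\leftarrow\mathbb Z_2^{\circ N}\leftarrow\mathbb Z_2^{*N}$ are respectively $S^{N-1}_{\mathbb R}\subset S^{N-1}_{\mathbb R,*}\subset S^{N-1}_{\mathbb R,\infty}$, and the associated quantum affine isometry groups are $$G^+(S^{N-1}_{\mathbb R})=O_N,\qquad G^+(S^{N-1}_{\mathbb R,*})=O_N^*,\qquad G^+(S^{N-1}_{\mathbb R,\infty})=H_N^{[\infty]},$$ with $O_N\subset O_N^*$ being an inclusion (and with no inclusion map between $O_N^*$ and $H_N^{[\infty]}$).
   Context: $O_N^+$ is the free orthogonal quantum group: $C(O_N^+)$ is the universal $C^*$-algebra generated by the entries of an $N\times N$ matrix $u=(u_{ij})$ with $u=\bar u$, $u^t=u^{-1}$, with $\Delta(u_{ij})=\sum_ku_{ik}\otimes u_{kj}$. Closed quantum subgroups $G\subset O_N^+$ correspond to quotients $C(G)$ of $C(O_N^+)$ to which the quantum group structure factors. $O_N^*\subset O_N^+$ is defined by the relations $abc=cba$ for all $a,b,c\in\{u_{ij}\}$, and $H_N^{[\infty]}\subset O_N^+$ by the relations $abc=0$ for all $a,b,c\in\{u_{ij}\}$ with $a\neq c$ on the same row or column of $u$. The free real sphere is $C(S^{N-1}_{\mathbb R,+})=C^*(x_1,\ldots,x_N\mid x_i=x_i^*,\ \sum_ix_i^2=1)$; closed subsets correspond to quotient $C^*$-algebras. $S^{N-1}_{\mathbb R}$ is the usual sphere (relations $x_ix_j=x_jx_i$), $S^{N-1}_{\mathbb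 R,*}$ is obtained via $x_ix_jx_k=x_kx_jx_i$, and $S^{N-1}_{\mathbb R,\infty}$ via $x_i^2x_j=x_jx_i^2$, for all $i,j,k$. A reflection group $\Gamma=\langle g_1,\ldots,g_N\rangle$, $g_i^2=1$, with $\mathbb Z_2^{*N}\to\Gamma\to\mathbb Z_2^N$ (quotient maps sending generators to generators), is uniform if each $\sigma\in S_N$ produces an automorphism $g_i\to g_{\sigma(i)}$. The untwisted monomial sphere coming from a uniform $\Gamma$ is the subset of $S^{N-1}_{\mathbb R,+}$ obtained by imposing $x_{i_1}\cdots x_{i_k}=x_{j_1}\cdots x_{j_k}$ whenever $g_{i_1}\cdots g_{i_k}=g_{j_1}\cdots g_{j_k}$ in $\Gamma$, for words $i,j$ of the same length in which each index occurs equally often. $\mathbb Z_2^{\circ N}$ is the quotient of the free product $\mathbb Z_2^{*N}$ by the relations $abc=cba$ between the generators. $G\subset O_N^+$ acts affinely on $X\subset S^{N-1}_{\mathbb R,+}$, written $G\curvearrowright X$, if $\Phi(x_i)=\sum_ju_{ij}\otimes x_j$ defines a coaction map $C(X)\to C(G)\otimes C(X)$, and $G^+(X)=\max\{G\subset O_N^+\mid G\curvearrowright X\}$.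
   Formalization: The equality G^+(S^{N-1}_{R,∞}) = H_N^{[∞]} is stated only for N ≠ 2 (at N = 2 this sphere is the free sphere), and the absence of inclusions between O_N^* and H_N^{[∞]} only for N ≥ 3 (O_1^* = H_1^{[∞]} and H_2^{[∞]} ⊂ O_2^* ). *)

(* Defs.v *)
From HB Require Import structures.
From mathcomp Require Import all_boot all_order all_algebra all_fingroup.
From mathcomp Require Import all_classical all_reals topology normedtype.
From mathcomp Require Import complex.

Set Implicit Arguments.
Unset Strict Implicit.
Unset Printing Implicit Defensive.

Import Order.TTheory GRing.Theory Num.Theory.
Import numFieldNormedType.Exports.
Import Normc.

Local Open Scope ring_scope.
Local Open Scope complex_scope.

(* The norm takes its values in R, and [normc] is the modulus on R[i].  The
   underlying [algType] is a nonzero ring, so the zero algebra is excluded. *)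
HB.mixin Record isCstarAlgebra (R : realType) A of GRing.Algebra R[i] A := {
  star : A -> A;
  cnorm : A -> R;
  starK : involutive star;
  starD : {morph star : x y / x + y};
  starZ : forall (c : R[i]) (x : A), star (c *: x) = c^* *: star x;
  starM : forall x y : A, star (x * y) = star y * star x;
  cnorm_eq0 : forall x : A, cnorm x = 0 -> x = 0;
  cnormD : forall x y : A, cnorm (x + y) <= cnorm x + cnorm y;
  cnormZ : forall (c : R[i]) (x : A), cnorm (c *: x) = normc c * cnorm x;
  cnormM : forall x y : A, cnorm (x * y) <= cnorm x * cnorm y;
  cstar_identity : forall x : A, cnorm (star x * x) = cnorm x ^+ 2;
  cstar_complete : forall s : nat -> A,
    (forall e : R, 0 < e -> exists n0, forall m n, (n0 <= m)%N -> (n0 <= n)%N ->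
       cnorm (s m - s n) < e) ->
    exists l, forall e : R, 0 < e ->
      exists n0, forall n, (n0 <= n)%N -> cnorm (s n - l) < e }.

#[short(type="cstarType")]
HB.structure Definition CstarAlgebra (R : realType) :=
  { A of GRing.Algebra R[i] A & isCstarAlgebra R A }.

(* Unital *-homomorphisms.  A *-homomorphism between C*-algebras is always
   contractive; the field [smorph_contr] records this well-known fact. *)
HB.mixin Record isStarMorphism (R : realType) (A B : cstarType R) (f : A -> B) := {
  smorph_star : {morph f : x / star x};
  smorph_contr : forall x, cnorm (f x) <= cnorm x }.

#[short(type="starMorphism")]
HB.structure Definition StarMorphism (R : realType) (A B : cstarType R) :=
  { f of @GRing.LRMorphism R[i] A B *:%R f & isStarMorphism R A B f }.

Section IdStarMorphism.
Variables (R : realType) (A : cstarType R).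
Fact id_smorph_star : {morph (idfun : A -> A) : x / star x}. Proof. by []. Qed.
Fact id_smorph_contr x : cnorm ((idfun : A -> A) x) <= cnorm x. Proof. by []. Qed.
HB.instance Definition _ := isStarMorphism.Build R A A idfun
  id_smorph_star id_smorph_contr.
End IdStarMorphism.

Definition id_star (R : realType) (A : cstarType R) : starMorphism A A := idfun.

Section ComplexCstar.
Variable R : realType.
Local Notation C := (R[i]^o).

Fact cplx_starD : {morph (conjc : C -> C) : x y / x + y}.
Proof. by move=> x y; exact: (rmorphD (@conjc R)). Qed.
Fact cplx_starZ (c : R[i]) (x : C) : conjc (c *: x : C) = (c^* *: (conjc x : C)).
Proof. exact: (rmorphM (@conjc R)). Qed.
Fact cplx_starM (x y : C) : conjc (x * y : C) = (conjc y : C) * conjc x.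
Proof. by rewrite mulrC; exact: (rmorphM (@conjc R)). Qed.
Fact cplx_identity (x : C) : normc ((conjc x : C) * x) = normc x ^+ 2.
Proof. by rewrite normcM expr2; congr (_ * _); case: x => a b /=; rewrite sqrrN. Qed.

Lemma real_seq_complete (s : nat -> R) :
  (forall e : R, 0 < e -> exists n0, forall m n, (n0 <= m)%N -> (n0 <= n)%N ->
     `|s m - s n| < e) ->
  exists l, forall e : R, 0 < e ->
    exists n0, forall n, (n0 <= n)%N -> `|s n - l| < e.
Proof.
move=> sC.
have /cvg_ex[/= l sl] : cvg (s @ \oo)%classic.
  apply: R_complete; apply/cauchy_exP => e e0.
  have [n0 Hn0] := sC _ e0; exists (s n0); exists n0 => //= n hn.
  exact: Hn0.
exists l => e e0.
have /cvgrPdist_lt /(_ _ e0) [n0 _ Hn0] := sl.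
by exists n0 => n /Hn0; rewrite distrC.
Qed.

Lemma normc_ge_parts (x : R[i]) : (`|complex.Re x| <= normc x) /\ (`|complex.Im x| <= normc x).
Proof.
case: x => a b /=; split; rewrite -sqrtr_sqr ler_sqrt ?addr_ge0 ?sqr_ge0 //.
  by rewrite lerDl sqr_ge0.
by rewrite lerDr sqr_ge0.
Qed.

Lemma normc_le_parts (x : R[i]) : normc x <= `|complex.Re x| + `|complex.Im x|.
Proof.
case: x => a b /=; rewrite -[leRHS]ger0_norm ?addr_ge0 // -sqrtr_sqr.
rewrite ler_sqrt ?sqr_ge0 // sqrrD !real_normK ?num_real //.
by rewrite addrAC lerDl mulrn_wge0 // mulr_ge0.
Qed.

Fact cplx_complete (s : nat -> C) :
  (forall e : R, 0 < e -> exists n0, forall m n, (n0 <= m)%N -> (n0 <= n)%N ->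
     normc (s m - s n) < e) ->
  exists l : C, forall e : R, 0 < e ->
    exists n0, forall n, (n0 <= n)%N -> normc (s n - l) < e.
Proof.
move=> sC.
have parts (z w : C) : `|complex.Re z - complex.Re w| <= normc (z - w) /\
    `|complex.Im z - complex.Im w| <= normc (z - w).
  by have := normc_ge_parts (z - w); case: z w => [a b] [c d].
have [a Ha] : exists l, forall e : R, 0 < e ->
    exists n0, forall n, (n0 <= n)%N -> `|complex.Re (s n) - l| < e.
  apply: real_seq_complete => e /sC[n0 Hn0]; exists n0 => m n hm hn.
  by apply: le_lt_trans (Hn0 m n hm hn); have [] := parts (s m) (s n).
have [b Hb] : exists l, forall e : R, 0 < e ->
    exists n0, forall n, (n0 <= n)%N -> `|complex.Im (s n) - l| < e.
  apply: real_seq_complete => e /sC[n0 Hn0]; exists n0 => m n hm hn.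
  by apply: le_lt_trans (Hn0 m n hm hn); have [] := parts (s m) (s n).
exists (a +i* b : C) => e e0.
have e20 : 0 < e / 2 by rewrite divr_gt0.
have [n1 H1] := Ha _ e20; have [n2 H2] := Hb _ e20.
exists (maxn n1 n2) => n; rewrite geq_max => /andP[/H1 h1 /H2 h2].
apply: le_lt_trans (normc_le_parts _) _; rewrite [e]splitr.
by move: h1 h2; case: (s n) => c d /= h1 h2; rewrite ltrD.
Qed.

Fact cplx_normD (x y : C) : normc (x + y) <= normc x + normc y.
Proof. by rewrite -lecR rmorphD /=; exact: (@ler_normD _ R[i]). Qed.
Fact cplx_normM (x y : C) : normc (x * y) <= normc x * normc y.
Proof. by rewrite normcM. Qed.

HB.instance Definition _ := isCstarAlgebra.Build R C
  (@conjcK R) cplx_starD cplx_starZ cplx_starM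
  (@eq0_normc R) cplx_normD (@normcM R)
  cplx_normM cplx_identity cplx_complete.
End ComplexCstar.

Section OppositeCstar.
Variables (R : realType) (A : cstarType R).

Definition cstar_op : Type := A.
HB.instance Definition _ := GRing.NzRing.copy cstar_op (A^c)%type.
HB.instance Definition _ :=
  @GRing.Zmodule_isLmodule.Build R[i] cstar_op (fun c (x : A) => c *: x : A)
  (@scalerA _ A) (@scale1r _ A) (@scalerDr _ A) (fun v a b => @scalerDl _ A v a b).

Fact op_scaleAl (c : R[i]) (x y : cstar_op) : c *: (x * y) = (c *: x) * y.
Proof. exact: (@scalerAr _ A). Qed.
HB.instance Definition _ :=
  GRing.Lmodule_isLalgebra.Build R[i] cstar_op op_scaleAl.
Fact op_scaleAr (c : R[i]) (x y : cstar_op) : c *: (x * y) = x * (c *: y).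
Proof. exact: (@scalerAl _ A). Qed.
HB.instance Definition _ :=
  GRing.Lalgebra_isAlgebra.Build R[i] cstar_op op_scaleAr.

Lemma cnorm_ge0 (x : A) : 0 <= cnorm x.
Proof.
have n0 : cnorm (0 : A) = 0 by rewrite -[0 in LHS](scale0r (0 : A)) cnormZ normc0 mul0r.
have := cnormD x ((-1) *: x).
rewrite cnormZ scaleN1r subrr n0 (_ : normc (-1) = 1) ?mul1r; last first.
  by rewrite /= oppr0 expr0n addr0 sqrrN expr1n sqrtr1.
by rewrite -mulr2n pmulrn_lge0.
Qed.

Lemma cnorm_star (x : A) : cnorm (star x) = cnorm x.
Proof.
suff le (y : A) : cnorm y <= cnorm (star y).
  by apply/eqP; rewrite eq_le le -[in leRHS](starK x) le.
have [->|y0] := eqVneq (cnorm y) 0; first exact: cnorm_ge0.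
have ygt0 : 0 < cnorm y by rewrite lt0r y0 cnorm_ge0.
by rewrite -(ler_pM2r ygt0) -expr2 -cstar_identity cnormM.
Qed.

Fact op_starM (x y : cstar_op) :
  star (x * y : A) = (star (y : A) : cstar_op) * (star (x : A) : cstar_op).
Proof. exact: (@starM _ A). Qed.
Fact op_normM (x y : cstar_op) :
  cnorm (x * y : A) <= cnorm (x : A) * cnorm (y : A).
Proof. by rewrite mulrC; exact: (@cnormM _ A). Qed.
Fact op_identity (x : cstar_op) :
  cnorm ((star (x : A) : cstar_op) * x : A) = cnorm (x : A) ^+ 2.
Proof.
have := @cstar_identity _ A (star (x : A)).
by rewrite starK cnorm_star.
Qed.
HB.instance Definition _ := isCstarAlgebra.Build R cstar_op
  (@starK _ A) (@starD _ A) (@starZ _ A) op_starM (@cnorm_eq0 _ A)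
  (@cnormD _ A) (@cnormZ _ A) op_normM op_identity (@cstar_complete _ A).
End OppositeCstar.

(* [generates E]: the smallest norm-closed unital *-subalgebra containing [E]
    is the whole algebra. *)
Section Generation.
Variables (R : realType) (A : cstarType R).

Definition norm_closed (B : A -> Prop) : Prop :=
  forall (s : nat -> A) (l : A), (forall n, B (s n)) ->
    (forall e : R, 0 < e ->
       exists n0, forall n, (n0 <= n)%N -> cnorm (s n - l) < e) ->
    B l.

Record cstar_subalgebra (B : A -> Prop) : Prop := {
  csub1 : B 1;
  csubD : forall x y, B x -> B y -> B (x + y);
  csubZ : forall (c : R[i]) x, B x -> B (c *: x);
  csubM : forall x y, B x -> B y -> B (x * y);
  csub_star : forall x, B x -> B (star x);
  csub_closed : norm_closed B }.

Definition generates (E : A -> Prop) : Prop :=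
  forall B, cstar_subalgebra B -> (forall x, E x -> B x) -> forall x, B x.

Definition lin_indep (n : nat) (b : 'I_n -> A) : Prop :=
  forall c : 'I_n -> R[i], \sum_k c k *: b k = 0 -> forall k, c k = 0.
End Generation.

(* A C*-completion of the algebraic tensor product of A and B, where
   [a (x) b] is [tinl a * tinr b].  The field [tens_inj] says that the algebraic
   tensor product embeds, since each of its elements is a sum of a_k (x) b_k
   with linearly independent b_k. *)
Record tensor_product (R : realType) (A B : cstarType R) := TensorProduct {
  tens_alg :> cstarType R;
  tinl : starMorphism A tens_alg;
  tinr : starMorphism B tens_alg;
  tens_comm : forall a b, tinl a * tinr b = tinr b * tinl a;
  tens_inj : forall n (a : 'I_n -> A) (b : 'I_n -> B), lin_indep b ->
    \sum_k tinl (a k) * tinr (b k) = 0 -> forall k, a k = 0;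
  tens_gen : generates (fun t => (exists a, t = tinl a) \/ (exists b, t = tinr b)) }.

Arguments tinl {R A B} _.
Arguments tinr {R A B} _.

(* A functorial and associative choice of the tensor product: the minimal and
   the maximal C*-tensor products are the standard examples. *)
Record tensor_functor (R : realType) := TensorFunctor {
  tens :> forall A B : cstarType R, tensor_product A B;
  tmap : forall A A' B B' : cstarType R,
    starMorphism A A' -> starMorphism B B' ->
    starMorphism (tens A B) (tens A' B');
  tmap_inl : forall A A' B B' (f : starMorphism A A') (g : starMorphism B B') a,
    tmap f g (tinl (tens A B) a) = tinl (tens A' B') (f a);
  tmap_inr : forall A A' B B' (f : starMorphism A A') (g : starMorphism B B') b,
    tmap f g (tinr (tens A B) b) = tinr (tens A' B') (g b);
  tassoc : forall A B C : cstarType R,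
    starMorphism (tens A (tens B C)) (tens (tens A B) C);
  tassoc_bij : forall A B C, bijective (tassoc A B C);
  tassoc_1 : forall A B C a,
    tassoc A B C (tinl (tens A (tens B C)) a) =
    tinl (tens (tens A B) C) (tinl (tens A B) a);
  tassoc_2 : forall A B C b,
    tassoc A B C (tinr (tens A (tens B C)) (tinl (tens B C) b)) =
    tinl (tens (tens A B) C) (tinr (tens A B) b);
  tassoc_3 : forall A B C c,
    tassoc A B C (tinr (tens A (tens B C)) (tinr (tens B C) c)) =
    tinr (tens (tens A B) C) c }.

Section Spheres.
Variables (R : realType) (N : nat).

Definition sphere_coords (A : cstarType R) (x : 'I_N -> A) : Prop :=
  (forall i, star (x i) = x i) /\ \sum_i x i ^+ 2 = 1.

(* A quotient of the universal algebra C(S^{N-1}_{R,+}) is a C*-algebra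
   generated by elements subject to the relations of the free sphere. *)
Record sphere_subset := SphereSubset {
  sph_alg :> cstarType R;
  coord : 'I_N -> sph_alg;
  coordP : sphere_coords coord;
  coord_gen : generates (fun a => exists i, a = coord i) }.

Arguments coord : clear implicits.

Definition sphere_sub (X Y : sphere_subset) : Prop :=
  exists f : starMorphism Y X, forall i, f (coord Y i) = coord X i.

Definition sphere_relation := forall A : cstarType R, ('I_N -> A) -> Prop.

(* C(X) is the universal C*-algebra given by the relations of the free sphere
   together with the relations [P]. *)
Definition sphere_defined_by (P : sphere_relation) (X : sphere_subset) : Prop :=
  P X (coord X) /\
  forall (A : cstarType R) (x : 'I_N -> A), sphere_coords x -> P A x ->
    exists f : starMorphism X A, forall i, f (coord X i) = x i.

Definition is_real_sphere : sphere_subset -> Prop :=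
  sphere_defined_by (fun A x => forall i j, x i * x j = x j * x i).

Definition is_half_liberated_sphere : sphere_subset -> Prop :=
  sphere_defined_by
    (fun A x => forall i j k, x i * x j * x k = x k * x j * x i).

Definition is_infinity_sphere : sphere_subset -> Prop :=
  sphere_defined_by
    (fun A x => forall i j, x i ^+ 2 * x j = x j * x i ^+ 2).
End Spheres.

Arguments coord {R N} _ _.

Section PresentedReflectionGroup.
Variables (N : nat) (rel : seq 'I_N -> seq 'I_N -> Prop).

(* Words in g_1, ..., g_N, modulo g_i^2 = 1 and the relations [rel]. *)
Inductive word_cong : seq 'I_N -> seq 'I_N -> Prop :=
| wc_refl s : word_cong s s
| wc_sym s t : word_cong s t -> word_cong t s
| wc_trans s t u : word_cong s t -> word_cong t u -> word_cong s u
| wc_cat s s' t t' : word_cong s s' -> word_cong t t' ->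
    word_cong (s ++ t) (s' ++ t')
| wc_sq i : word_cong [:: i; i] [::]
| wc_rel s t : rel s t -> word_cong s t.

Definition word_eq (s t : seq 'I_N) : bool := `[< word_cong s t >].

Fact word_eq_refl : reflexive word_eq.
Proof. by move=> s; apply/asboolP; apply: wc_refl. Qed.
Fact word_eq_sym : symmetric word_eq.
Proof. by move=> s t; apply/asboolP/asboolP; apply: wc_sym. Qed.
Fact word_eq_trans : transitive word_eq.
Proof.
by move=> t s u /asboolP st /asboolP tu; apply/asboolP; apply: wc_trans st tu.
Qed.

Definition word_equiv := EquivRel word_eq word_eq_refl word_eq_sym word_eq_trans.
Definition refl_pres : Type := {eq_quot word_equiv}%qT.
HB.instance Definition _ := Choice.on refl_pres.

Definition of_word (s : seq 'I_N) : refl_pres := (\pi_({eq_quot word_equiv}) s)%qT.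
Definition to_word (x : refl_pres) : seq 'I_N := generic_quotient.repr (x : {eq_quot word_equiv}%qT).

Lemma of_wordP s t : of_word s = of_word t <-> word_cong s t.
Proof.
by split=> [/eqquotP/asboolP //|st]; apply/eqquotP/asboolP.
Qed.
Lemma to_wordK : cancel to_word of_word.
Proof. exact: generic_quotient.reprK. Qed.
Lemma of_wordK s : word_cong (to_word (of_word s)) s.
Proof. by apply/of_wordP; rewrite to_wordK. Qed.

Lemma wc_rev s : word_cong (rev s ++ s) [::].
Proof.
elim: s => [|i s IHs]; first exact: wc_refl.
rewrite rev_cons cat_rcons -[i :: i :: s]/([:: i; i] ++ s).
apply: wc_trans IHs; apply: wc_cat; first exact: wc_refl.
rewrite -[X in word_cong _ X]cat0s; apply: wc_cat; [exact: wc_sq | exact: wc_refl].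
Qed.

Definition rp_mul (x y : refl_pres) := of_word (to_word x ++ to_word y).
Definition rp_inv (x : refl_pres) := of_word (rev (to_word x)).

Lemma of_word_cat s t : rp_mul (of_word s) (of_word t) = of_word (s ++ t).
Proof. by apply/of_wordP; apply: wc_cat; apply: of_wordK. Qed.

Fact rp_mulA : associative rp_mul.
Proof.
move=> x y z; rewrite -[x]to_wordK -[y]to_wordK -[z]to_wordK.
by rewrite !of_word_cat catA.
Qed.
Fact rp_mul1g : left_id (of_word [::]) rp_mul.
Proof. by move=> x; rewrite -[x]to_wordK of_word_cat. Qed.
Fact rp_mulg1 : right_id (of_word [::]) rp_mul.
Proof. by move=> x; rewrite -[x]to_wordK of_word_cat cats0. Qed.
Fact rp_mulVg : left_inverse (of_word [::]) rp_inv rp_mul.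
Proof.
move=> x; rewrite -{2}[x]to_wordK /rp_inv of_word_cat.
by apply/of_wordP; apply: wc_rev.
Qed.
Fact rp_mulgV : right_inverse (of_word [::]) rp_inv rp_mul.
Proof.
move=> x; rewrite -{1}[x]to_wordK /rp_inv of_word_cat.
by apply/of_wordP; rewrite -{1}[to_word x]revK; apply: wc_rev.
Qed.
HB.instance Definition _ := isGroup.Build refl_pres
  rp_mulA rp_mul1g rp_mulg1 rp_mulVg rp_mulgV.

Definition rp_gen (i : 'I_N) : refl_pres := of_word [:: i].

Lemma rp_genE s : (\prod_(i <- s) rp_gen i)%g = of_word s.
Proof.
elim: s => [|i s IHs]; first by rewrite big_nil.
by rewrite big_cons IHs; exact: of_word_cat.
Qed.
End PresentedReflectionGroup.

Definition group_hom (G H : groupType) (f : G -> H) : Prop :=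
  {morph f : x y / (x * y)%g}.

Definition group_quotient (N : nat) (G H : groupType)
    (g : 'I_N -> G) (h : 'I_N -> H) : Prop :=
  exists f : G -> H,
    [/\ group_hom f, forall y, exists x, f x = y & forall i, f (g i) = h i].

Lemma group_hom1 (G H : groupType) (f : G -> H) : group_hom f -> f 1%g = 1%g.
Proof.
move=> fM; apply: (@mulgI _ (f 1%g)).
by rewrite -fM !mulg1.
Qed.

Lemma group_hom_prod (G H : groupType) (f : G -> H) : group_hom f ->
  forall (I : Type) (s : seq I) (g : I -> G),
    f (\prod_(i <- s) g i)%g = (\prod_(i <- s) f (g i))%g.
Proof.
by move=> fM I s g; elim: s => [|i s IHs];
  rewrite ?big_nil ?group_hom1 // !big_cons fM IHs.
Qed.

Lemma rp_lift (N : nat) (rel : seq 'I_N -> seq 'I_N -> Prop) (H : groupType)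
    (h : 'I_N -> H) :
  (forall i, h i * h i = 1)%g ->
  (forall s t, rel s t -> \prod_(i <- s) h i = \prod_(i <- t) h i)%g ->
  exists2 f : refl_pres rel -> H, group_hom f & forall i, f (rp_gen rel i) = h i.
Proof.
move=> h2 hrel.
have hc s t : word_cong rel s t -> (\prod_(i <- s) h i = \prod_(i <- t) h i)%g.
  elim=> {s t} [//|s t _ -> //|s t u _ -> _ -> //|s s' t t' _ Es _ Et|i|s t /hrel //].
    by rewrite !big_cat /= Es Et.
  by rewrite !big_cons big_nil mulg1 h2.
exists (fun x => \prod_(i <- to_word x) h i)%g => [x y|i].
  rewrite -big_cat; apply: hc; exact: of_wordK.
by rewrite (hc _ _ (of_wordK rel [:: i])) big_seq1.
Qed.

Lemma gen_quotient (N : nat) (G H : groupType) (g : 'I_N -> G) (h : 'I_N -> H)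
    (f : G -> H) :
  group_hom f -> (forall i, f (g i) = h i) ->
  (forall y : H, exists s, y = \prod_(i <- s) h i)%g -> group_quotient g h.
Proof.
move=> fM fg hgen; exists f; split=> // y; have [s ->] := hgen y.
exists (\prod_(i <- s) g i)%g; rewrite (group_hom_prod fM).
by apply: eq_bigr => i _; rewrite fg.
Qed.

Definition Z2free (N : nat) : groupType := refl_pres (fun s t : seq 'I_N => False).
Definition Z2free_gen (N : nat) (i : 'I_N) : Z2free N := rp_gen _ i.

(* 'Z_2 carries its additive group law in [group_scope]. *)
Definition Z2pow (N : nat) : groupType := {ffun 'I_N -> 'Z_2}.
Definition Z2pow_gen (N : nat) (i : 'I_N) : Z2pow N :=
  [ffun k => if k == i then 1%R else 0%R : 'Z_2].

Definition half_rel (N : nat) (s t : seq 'I_N) : Prop :=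
  exists i j k, s = [:: i; j; k] /\ t = [:: k; j; i].
Definition Z2half (N : nat) : groupType := refl_pres (@half_rel N).
Definition Z2half_gen (N : nat) (i : 'I_N) : Z2half N := rp_gen _ i.

Record reflection_group (N : nat) := ReflectionGroup {
  rgrp :> groupType;
  rgen : 'I_N -> rgrp;
  rgen_sq : forall i, (rgen i * rgen i = 1)%g;
  rgrp_from_free : group_quotient (@Z2free_gen N) rgen;
  rgrp_to_pow : group_quotient rgen (@Z2pow_gen N) }.

Arguments rgen {N} _ _.

Definition uniform (N : nat) (Gam : reflection_group N) : Prop :=
  forall sg : 'S_N, exists f : Gam -> Gam,
    [/\ group_hom f, bijective f & forall i, f (rgen Gam i) = rgen Gam (sg i)].

Record uniform_reflection_group (N : nat) := UniformReflectionGroup {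
  urg :> reflection_group N;
  urgP : uniform urg }.

Section BasicReflectionGroups.
Variable N : nat.

Lemma rp_gens rel (y : @refl_pres N rel) : exists s, (y = \prod_(i <- s) rp_gen rel i)%g.
Proof. by exists (to_word y); rewrite rp_genE to_wordK. Qed.

Lemma rp_gen_sq rel i : (@rp_gen N rel i * rp_gen rel i = 1)%g.
Proof.
by have := rp_genE rel [:: i; i]; rewrite !big_cons big_nil mulg1 => ->;
  apply/of_wordP; apply: wc_sq.
Qed.

Lemma rp_relP rel s t : rel s t ->
  (\prod_(i <- s) @rp_gen N rel i = \prod_(i <- t) rp_gen rel i)%g.
Proof. by move=> st; rewrite !rp_genE; apply/of_wordP; apply: wc_rel. Qed.

Lemma Z2pow_mulE (x y : Z2pow N) k : (x * y)%g k = (x k + y k)%R.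
Proof. by rewrite ffunE. Qed.

Lemma Z2pow_mulC (x y : Z2pow N) : (x * y = y * x)%g.
Proof. by apply/ffunP => k; rewrite !Z2pow_mulE addrC. Qed.

Lemma Z2pow_gen_sq i : (@Z2pow_gen N i * Z2pow_gen i = 1)%g.
Proof.
apply/ffunP => k; rewrite Z2pow_mulE !ffunE.
by case: eqP => _; apply: val_inj.
Qed.

Lemma Z2pow_gens (y : Z2pow N) : exists s, (y = \prod_(i <- s) Z2pow_gen i)%g.
Proof.
have prodE s k : (\prod_(i <- s) @Z2pow_gen N i)%g k = \sum_(i <- s) (Z2pow_gen i k).
  elim: s => [|i s IHs]; first by rewrite !big_nil ffunE.
  by rewrite !big_cons Z2pow_mulE IHs.
exists [seq i <- enum 'I_N | y i != 0]; apply/ffunP => k.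
rewrite prodE big_filter big_enum_cond /=.
have [yk0|yk1] := eqVneq (y k) 0.
  rewrite yk0 big1 // => i yi; rewrite ffunE; case: eqP => // ki.
  by move: yi; rewrite -ki yk0.
rewrite (bigD1 k) //= big1 ?addr0 => [|i /andP[_ ik]]; last first.
  by rewrite ffunE eq_sym (negPf ik).
by rewrite ffunE eqxx; move: yk1; case: (y k) => [[|[|]]] //= ? _; apply/val_inj.
Qed.

Lemma free_quotient (H : groupType) (h : 'I_N -> H) :
  (forall i, h i * h i = 1)%g ->
  (forall y : H, exists s, y = \prod_(i <- s) h i)%g ->
  group_quotient (@Z2free_gen N) h.
Proof.
move=> h2 hgen; have [f fM fg] := @rp_lift N (fun _ _ => False) H h h2 (fun _ _ => False_ind _).
exact: gen_quotient fM fg hgen.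
Qed.

Lemma pow_quotient rel :
  (forall s t, rel s t ->
     \prod_(i <- s) @Z2pow_gen N i = \prod_(i <- t) Z2pow_gen i)%g ->
  group_quotient (@rp_gen N rel) (@Z2pow_gen N).
Proof.
move=> hrel; have [f fM fg] := rp_lift Z2pow_gen_sq hrel.
exact: gen_quotient fM fg Z2pow_gens.
Qed.

Lemma half_pow s t : half_rel s t ->
  (\prod_(i <- s) @Z2pow_gen N i = \prod_(i <- t) Z2pow_gen i)%g.
Proof.
move=> [i [j [k [-> ->]]]]; rewrite !big_cons big_nil !mulg1.
by rewrite (Z2pow_mulC (Z2pow_gen i)) (Z2pow_mulC (Z2pow_gen j)) mulgA.
Qed.

Lemma id_group_quotient (G : groupType) (g : 'I_N -> G) : group_quotient g g.
Proof. by exists id; split=> // y; exists y. Qed.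

Definition Z2free_rg : reflection_group N :=
  @ReflectionGroup N (Z2free N) (@Z2free_gen N) (@rp_gen_sq _)
    (id_group_quotient _) (pow_quotient (fun _ _ => False_ind _)).

Definition Z2half_rg : reflection_group N :=
  @ReflectionGroup N (Z2half N) (@Z2half_gen N) (@rp_gen_sq _)
    (free_quotient (@rp_gen_sq _) (@rp_gens _))
    (pow_quotient half_pow).

Definition Z2pow_rg : reflection_group N :=
  @ReflectionGroup N (Z2pow N) (@Z2pow_gen N) Z2pow_gen_sq
    (free_quotient Z2pow_gen_sq Z2pow_gens) (id_group_quotient _).

Lemma rp_uniform rel :
  (forall (sg : 'S_N) s t, rel s t -> rel (map sg s) (map sg t)) ->
  forall sg : 'S_N, exists f : refl_pres rel -> refl_pres rel,
    [/\ group_hom f, bijective f & forall i, f (rp_gen rel i) = rp_gen rel (sg i)].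
Proof.
move=> relS.
have lift (sg : 'S_N) : exists2 f : refl_pres rel -> refl_pres rel,
    group_hom f & forall i, f (rp_gen rel i) = rp_gen rel (sg i).
  apply: rp_lift => [i|s t /(relS sg) /rp_relP]; first exact: rp_gen_sq.
  by rewrite !big_map.
move=> sg; have [f fM fg] := lift sg; have [f' f'M f'g] := lift (sg^-1)%g.
exists f; split=> //; exists f' => x; have [s ->] := rp_gens x;
  rewrite !(group_hom_prod fM, group_hom_prod f'M); apply: eq_bigr => i _.
  by rewrite fg f'g permK.
by rewrite f'g fg permKV.
Qed.

Fact Z2free_uniform : uniform Z2free_rg.
Proof. exact: rp_uniform. Qed.

Fact Z2half_uniform : uniform Z2half_rg.
Proof.
apply: rp_uniform => sg s t [i [j [k [-> ->]]]].
by exists (sg i), (sg j), (sg k).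
Qed.

Fact Z2pow_uniform : uniform Z2pow_rg.
Proof.
move=> sg; exists (fun x : Z2pow N => [ffun k => x ((sg^-1)%g k)] : Z2pow N).
split=> [x y||i].
- by apply/ffunP => k; rewrite ffunE !Z2pow_mulE !ffunE.
- exists (fun x : Z2pow N => [ffun k => x (sg k)] : Z2pow N) => x;
    by apply/ffunP => k; rewrite !ffunE ?permK ?permKV.
- by apply/ffunP => k; rewrite !ffunE (canF_eq (permKV sg)).
Qed.

Definition Z2free_urg := UniformReflectionGroup Z2free_uniform.
Definition Z2half_urg := UniformReflectionGroup Z2half_uniform.
Definition Z2pow_urg := UniformReflectionGroup Z2pow_uniform.
End BasicReflectionGroups.

(* For index words, [perm_eq] says that they have the same length and that each
   index occurs equally often in both. *)
Definition is_monomial_sphere (R : realType) (N : nat)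
    (Gam : uniform_reflection_group N) : sphere_subset R N -> Prop :=
  sphere_defined_by (fun A x => forall s t : seq 'I_N, perm_eq s t ->
    (\prod_(i <- s) rgen Gam i)%g = (\prod_(i <- t) rgen Gam i)%g ->
    \prod_(i <- s) x i = \prod_(i <- t) x i).

Section QuantumGroups.
Variables (R : realType) (T : tensor_functor R) (N : nat).

Definition orthogonal_mx (A : cstarType R) (u : 'M[A]_N) : Prop :=
  [/\ forall i j, star (u i j) = u i j, u *m u^T = 1%:M & u^T *m u = 1%:M].

(* A quotient of C(O_N^+) is a C*-algebra generated by the entries of an
   orthogonal matrix. *)
Record oplus_subset := OplusSubset {
  oplus_alg :> cstarType R;
  umx : 'M[oplus_alg]_N;
  umxP : orthogonal_mx umx;
  umx_gen : generates (fun a => exists i j, a = umx i j) }.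

Arguments umx : clear implicits.

(* The comultiplication, counit and antipode of C(O_N^+) factor to the
   quotient. *)
Record quantum_group_structure (Q : oplus_subset) := QuantumGroupStructure {
  comult : starMorphism Q (T Q Q);
  comultE : forall i j, comult (umx Q i j) =
    \sum_k tinl (T Q Q) (umx Q i k) * tinr (T Q Q) (umx Q k j);
  counit : starMorphism Q R[i]^o;
  counitE : forall i j, counit (umx Q i j) = (i == j)%:R;
  antipode : starMorphism Q (cstar_op Q);
  antipodeE : forall i j, antipode (umx Q i j) = umx Q j i }.

Record quantum_subgroup := QuantumSubgroup {
  qset :> oplus_subset;
  qstr : quantum_group_structure qset }.

Definition oplus_sub (Q Q' : oplus_subset) : Prop :=
  exists f : starMorphism Q' Q, forall i j, f (umx Q' i j) = umx Q i j.

Definition oplus_relation := forall A : cstarType R, 'M[A]_N -> Prop.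

Definition oplus_defined_by (P : oplus_relation) (Q : oplus_subset) : Prop :=
  P Q (umx Q) /\
  forall (A : cstarType R) (v : 'M[A]_N), orthogonal_mx v -> P A v ->
    exists f : starMorphism Q A, forall i j, f (umx Q i j) = v i j.

Definition is_O : oplus_subset -> Prop :=
  oplus_defined_by (fun A u => forall i j k l, u i j * u k l = u k l * u i j).

Definition is_Ostar : oplus_subset -> Prop :=
  oplus_defined_by (fun A u => forall i j k l p q,
    u i j * u k l * u p q = u p q * u k l * u i j).

Definition is_Hinfty : oplus_subset -> Prop :=
  oplus_defined_by (fun A u => forall i j k l p q,
    (i, j) != (p, q) -> (i == p) || (j == q) ->
    u i j * u k l * u p q = 0).

(* Coassociativity (Delta (x) id) Phi = (id (x) Phi) Phi and counitality
   (eps (x) id) Phi = id. *)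
Definition is_coaction (G : quantum_subgroup) (B : cstarType R)
    (Phi : starMorphism B (T G B)) : Prop :=
  (forall b, tassoc T G G B (tmap T (id_star G) Phi (Phi b)) =
             tmap T (comult (qstr G)) (id_star B) (Phi b)) /\
  (forall b, tmap T (counit (qstr G)) (id_star B) (Phi b) = tinr (T R[i]^o B) b).

Definition acts_affinely (G : quantum_subgroup) (X : sphere_subset R N) : Prop :=
  exists2 Phi : starMorphism X (T G X),
    is_coaction Phi &
    forall i, Phi (coord X i) =
      \sum_j tinl (T G X) (umx G i j) * tinr (T G X) (coord X j).

Definition is_affine_isometry_group (X : sphere_subset R N) (Q : oplus_subset) :
    Prop :=
  (exists s : quantum_group_structure Q, acts_affinely (QuantumSubgroup s) X) /\
  (forall G : quantum_subgroup, acts_affinely G X -> oplus_sub G Q).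
End QuantumGroups.

(* Main.v *)
(* A word in the generators of a basic reflection group is governed by the
   letters in odd and in even positions (half-liberated case), respectively by
   its reduced form (free case); this turns the monomial relations into the
   defining relations of the spheres.  The relations of O_N, O_N^* and
   H_N^[oo] pass to sum_k u_ik (x) u_kj and to sum_j u_ij (x) x_j, which gives
   the quantum groups and their actions.

   For maximality, let y_i = sum_j u_ij (x) x_j satisfy the relations of the
   sphere and represent the sphere in M_n(C) by sending x_a to k^{-1/2} times
   the permutation matrix of an involution for a in a set of k indices, and to
   0 otherwise.  Matrix entries of the relations then isolate single words in
   the u_ij.  The antipode supplies the transposed relations: for O_N and
   O_N^* this turns an antisymmetric expression into a symmetric one, so it
   vanishes.  For H_N^[oo] it makes the squares q_ia = u_ia^2 central, and the
   remaining relation u_ia u_ib u_jc = u_ja u_ib u_ic (a <> b <> c) forces, for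
   N >= 3 and a <> b, all q_jx to equal 1/N and all u_jx u_ix to coincide on the
   support of q_ia q_ib; since sum_x u_jx u_ix = 0, this support is empty. *)
From HB Require Import structures.
From mathcomp Require Import all_boot all_order all_algebra all_fingroup.
From mathcomp Require Import all_classical all_reals.
From mathcomp Require Import complex zify ring.
Require Import Defs.

Set Implicit Arguments.
Unset Strict Implicit.
Unset Printing Implicit Defensive.

Import Order.TTheory GRing.Theory Num.Theory.
Import Normc.
Local Open Scope ring_scope.
Local Open Scope complex_scope.

(** * Words in the basic reflection groups *)

Lemma sphere_defined_by_iff (R : realType) (N : nat) (P P' : sphere_relation R N) :
  (forall A x, P A x <-> P' A x) ->
  forall X, sphere_defined_by P X <-> sphere_defined_by P' X.
Proof.
move=> PP' X; split=> -[PX univ]; split; try exact/PP'.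
  by move=> A x xS /PP'; apply: univ.
by move=> A x xS /PP'; apply: univ.
Qed.

Lemma perm_prod_comm (A : pzRingType) (I : eqType) (x : I -> A) (s t : seq I) :
  (forall i j, x i * x j = x j * x i) -> perm_eq s t ->
  \prod_(i <- s) x i = \prod_(i <- t) x i.
Proof.
move=> xC; elim: s t => [|i s IHs] t; first by rewrite perm_sym => /perm_nilP->.
move=> st; have it : i \in t by rewrite -(perm_mem st) mem_head.
case/splitPr: it st => r1 r2 st.
rewrite big_cat !big_cons /= (IHs (r1 ++ r2)); last first.
  by rewrite -(perm_cons i) (permPl st) -[i :: r2]cat1s perm_catCA.
by rewrite big_cat /= mulrA (commr_prod _ (fun j _ => xC i j)) mulrA.
Qed.

Section Words.
Variable N : nat.
Implicit Types s t : seq 'I_N.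

(* The letters in odd positions and those in even positions, counted from 1. *)
Fixpoint alternate s : seq 'I_N * seq 'I_N :=
  if s is i :: s' then (i :: (alternate s').2, (alternate s').1)
  else ([::], [::]).

Definition altcount i s : int :=
  (count_mem i (alternate s).1)%:Z - (count_mem i (alternate s).2)%:Z.

Lemma altcount_cons i j s : altcount i (j :: s) = (j == i)%:Z - altcount i s.
Proof. by rewrite /altcount /= PoszD opprB addrA. Qed.

Lemma altcount_cat i s t :
  altcount i (s ++ t) = altcount i s + (-1) ^+ size s * altcount i t.
Proof.
elim: s => [|j s IHs]; first by rewrite /= {2}/altcount subrr add0r expr0 mul1r.
by rewrite cat_cons !altcount_cons IHs /= exprS mulN1r mulNr opprD addrA.
Qed.

(** A square [i i] contributes opposite signs, and reversing three letters keeps the parity of every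
    position. The parity of the length is carried along because it decides the sign of the second
    factor in [altcount_cat]. *)
Lemma half_cong_altcount s t : word_cong (@half_rel N) s t ->
  odd (size s) = odd (size t) /\ forall i, altcount i s = altcount i t.
Proof.
elim=> {s t}.
- by [].
- by move=> s t _ [-> st]; split=> // i; rewrite st.
- by move=> s t u _ [-> st] _ [-> tu]; split=> // i; rewrite st tu.
- move=> s s' t t' _ [os ss'] _ [ot tt']; split=> [|i].
    by rewrite !size_cat !oddD os ot.
  by rewrite !altcount_cat ss' tt' -signr_odd os signr_odd.
- by move=> i; split=> // j; rewrite /altcount /= addn0 subrr.
- move=> s t [i [j [k [-> ->]]]]; split=> // l.
  by rewrite /altcount /= !addn0 addnC.
Qed.

Lemma count_alternate i s :
  (count_mem i (alternate s).1 + count_mem i (alternate s).2)%N = count_mem i s.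
Proof. by elim: s => //= j s <-; rewrite -addnA [in LHS](addnC (count_mem i _.2)%N). Qed.

Lemma mem_alternate1 i s : i \in (alternate s).1 ->
  exists s1 s2, s = s1 ++ i :: s2 /\ ~~ odd (size s1).
Proof.
have [n] := ubnP (size s); elim: n s => // n IHn [|j [|k s]] //= sn.
  by rewrite inE => /eqP->; exists [::], [::].
rewrite inE => /orP[/eqP->|]; first by exists [::], (k :: s).
case/IHn; first by move: sn; rewrite !ltnS; apply: ltnW.
by move=> s1 [s2 [-> os1]]; exists [:: j, k & s1], s2; rewrite /= negbK.
Qed.

Section HalfCommute.
Variables (A : pzRingType) (x : 'I_N -> A).
Hypothesis xC : forall i j k, x i * x j * x k = x k * x j * x i.
Local Notation px s := (\prod_(i <- s) x i).

(** Write [s = c d s']. The relation on [a c d] brings [a] next to the shorter word [s'], induction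
    swaps [a] and [b] around it, and the relation on [d c b] brings [b] to the front. *)
Lemma half_swap a b s : odd (size s) -> x a * px s * x b = x b * px s * x a.
Proof.
have [n] := ubnP (size s); elim: n s a b => // n IHn [|c [|d s]] //= a b sn os.
  by rewrite big_seq1 xC.
rewrite !big_cons.
have -> : x a * (x c * (x d * px s)) * x b = (x a * x c * x d) * px s * x b.
  by rewrite !mulrA.
rewrite xC -[LHS]mulrA -(mulrA (x d * x c)) [x a * _]mulrA IHn; last 2 first.
- by move: sn; rewrite !ltnS; apply: ltnW.
- by move: os; rewrite negbK.
rewrite !mulrA; do 2!congr (_ * _).
by rewrite xC.
Qed.

(** Equal total counts and equal alternating counts give equal counts in odd and in even positions.
    So the first letter of [t] stands in an odd position of [s], from where it can be moved to the
    front; then induction applies to the tails. *)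
Lemma half_prod s t : perm_eq s t -> (forall i, altcount i s = altcount i t) ->
  px s = px t.
Proof.
have [n] := ubnP (size s); elim: n s t => // n IHn s [|a t] sn st ac.
  by move/perm_nilP: st => ->.
suff [s' [ss' sz -> ac']] : exists s',
    [/\ perm_eq (a :: s') s, size s = (size s').+1, px s = px (a :: s') &
        forall i, altcount i (a :: s') = altcount i s].
  rewrite !big_cons; congr (_ * _); apply: IHn.
  - by move: sn; rewrite sz ltnS.
  - by rewrite -(perm_cons a); apply: seq.perm_trans ss' st.
  - by move=> i; have := ac' i; rewrite ac !altcount_cons => /addrI/oppr_inj.
have : a \in (alternate s).1.
  rewrite -has_pred1 has_count; have := ac a; rewrite altcount_cons /altcount eqxx.
  have := count_alternate a s; rewrite (seq.permP st) -(count_alternate a (a :: t)) /=.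
  move: (count_mem a _.1) (count_mem a _.2) (count_mem a _.1) (count_mem a _.2).
  by rewrite eqxx; lia.
(* Either [a] is already the first letter, or the first letter [b] is separated from it by the word
   [w] of odd length, and [half_swap] exchanges the two. *)
case/mem_alternate1 => -[|b w] [s2 [-> ow]]; first by exists s2; split.
rewrite /= negbK in ow; exists (w ++ b :: s2); split.
- rewrite -[a :: s2]cat1s -[a :: _ ++ _]cat1s perm_sym perm_catCA perm_cat2l.
  by rewrite -[b :: s2]cat1s perm_sym perm_catCA catA.
- by rewrite /= !size_cat.
- by rewrite cat_cons !big_cons !big_cat !big_cons /= !mulrA half_swap.
- move=> i; rewrite cat_cons !altcount_cons !altcount_cat !altcount_cons.
  by rewrite -signr_odd ow; ring.
Qed.
End HalfCommute.

(** Left multiplication by $g_i$ on reduced words, the normal forms of $\mathbb Z_2^{*N}$. *)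
Definition push i s : seq 'I_N :=
  if s is j :: s' then (if i == j then s' else i :: s) else [:: i].

Definition reduced s := if s is i :: s' then path (fun j k => j != k) i s' else true.

Lemma push_reduced i s : reduced s -> reduced (push i s).
Proof.
case: s => //= j s js; case: eqVneq => /= [_|->] //.
by case: s js => //= k s /andP[].
Qed.

Lemma pushK i s : reduced s -> push i (push i s) = s.
Proof.
case: s => [|j s] /=; first by rewrite eqxx.
case: (eqVneq i j) => [->|_]; last by rewrite /= eqxx.
by case: s => //= k s /andP[/negPf-> _].
Qed.

Lemma foldr_push_reduced s r : reduced r -> reduced (foldr push r s).
Proof. by move=> rr; elim: s => //= i s; apply: push_reduced. Qed.

(** By [pushK] every generator acts on reduced words as an involution, so words act through the
    group. The arbitrary start [r] is what lets the concatenation case go through. *)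
Lemma free_cong_reduce s t : word_cong (fun _ _ : seq 'I_N => False) s t ->
  forall r, reduced r -> foldr push r s = foldr push r t.
Proof.
elim=> {s t} //.
- by move=> s t _ st r /st.
- by move=> s t u _ st _ tu r rr; rewrite st ?tu.
- move=> s s' t t' _ ss' _ tt' r rr.
  by rewrite !foldr_cat tt' // ss' // foldr_push_reduced.
- by move=> i r rr; exact: pushK.
Qed.

Section CentralSquares.
Variables (A : pzRingType) (x : 'I_N -> A).
Hypothesis x2C : forall i j, x i ^+ 2 * x j = x j * x i ^+ 2.
Local Notation px s := (\prod_(i <- s) x i).

Lemma sq_prodC i s : x i ^+ 2 * px s = px s * x i ^+ 2.
Proof. by apply: commr_prod => j _; apply: x2C. Qed.

(** Each cancellation [i i] met while reducing [s] leaves a central square; [r] collects these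
    letters. *)
Lemma prod_reduce s : exists r,
  px s = px (foldr push [::] s) * \prod_(i <- r) x i ^+ 2 /\
  forall i, count_mem i s = (count_mem i (foldr push [::] s) + (count_mem i r).*2)%N.
Proof.
elim: s => [|i s [r [IHs IHc]]]; first by exists [::]; rewrite !big_nil mulr1.
rewrite big_cons IHs /=.
case: (foldr _ _ _) IHc => [|j s'] /= IHc.
  exists r; rewrite big_nil !big_cons big_nil mulr1 mul1r; split=> // k.
  by rewrite IHc !addn0.
case: eqVneq => [ij|_].
  exists (i :: r); split.
    by rewrite !big_cons -ij !mulrA -[x i * x i]expr2 sq_prodC expr2 !mulrA.
  by move=> k; rewrite IHc ij /=; case: (j == k); lia.
by exists r; split=> [|k]; rewrite ?IHc /= ?addnA // !big_cons !mulrA.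
Qed.

(** Both words have the same reduced form, so counting letters shows that they give off the same
    squares up to order, and squares commute. *)
Lemma central_sq_prod s t : perm_eq s t ->
  word_cong (fun _ _ : seq 'I_N => False) s t -> px s = px t.
Proof.
move=> st /free_cong_reduce/(_ [::] isT) red_st.
have [r [-> cs]] := prod_reduce s; have [r' [-> ct]] := prod_reduce t.
rewrite red_st; congr (_ * _); apply: perm_prod_comm => [i j|].
  exact: (commrX 2 (x2C i j)).
apply/allP => i _ /=.
have := seq.permP st (pred1 i); rewrite cs ct red_st => /addnI.
by rewrite -!muln2 => /eqP; rewrite eqn_pmul2r.
Qed.
End CentralSquares.
End Words.

Section MonomialSpheres.
Variables (R : realType) (N : nat).

Lemma monomial_pow (X : sphere_subset R N) :
  is_monomial_sphere (Z2pow_urg N) X <-> is_real_sphere X.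
Proof.
apply: sphere_defined_by_iff => A x; split=> [xP i j|xC s t st _].
  have := xP [:: i; j] [:: j; i]; rewrite !big_cons !big_nil !mulr1; apply.
    exact/permPl/(perm_catC [:: i] [:: j]).
  by rewrite !mulg1; apply: Z2pow_mulC.
exact: perm_prod_comm.
Qed.

Lemma monomial_half (X : sphere_subset R N) :
  is_monomial_sphere (Z2half_urg N) X <-> is_half_liberated_sphere X.
Proof.
apply: sphere_defined_by_iff => A x; split=> [xP i j k|xC s t st].
  have := xP [:: i; j; k] [:: k; j; i].
  rewrite !big_cons !big_nil !mulr1 !mulrA; apply.
    by rewrite -[[:: k; j; i]]/(rev [:: i; j; k]) perm_sym perm_rev.
  have := @rp_relP N (@half_rel N) [:: i; j; k] [:: k; j; i].
  by rewrite !big_cons !big_nil; apply; exists i, j, k.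
rewrite /= /Z2half_gen !rp_genE => /of_wordP/half_cong_altcount[_ ac].
exact: half_prod.
Qed.

Lemma monomial_free (X : sphere_subset R N) :
  is_monomial_sphere (Z2free_urg N) X <-> is_infinity_sphere X.
Proof.
apply: sphere_defined_by_iff => A x; split=> [xP i j|xC s t st].
  have := xP [:: i; i; j] [:: j; i; i].
  rewrite !big_cons !big_nil !mulr1 expr2 !mulrA; apply.
    exact/permPl/(perm_catC [:: i; i] [:: j]).
  by rewrite /= !mulg1 mulgA !rp_gen_sq mulg1 mul1g.
rewrite /= /Z2free_gen !rp_genE => /of_wordP.
exact: central_sq_prod.
Qed.
End MonomialSpheres.

(** * The C*-algebra of complex matrices *)

Lemma normc_ge0 (R : rcfType) (z : R[i]) : 0 <= normc z.
Proof. by case: z => a b; exact: sqrtr_ge0. Qed.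

Section VectorNorm.
Variables (R : realType) (n : nat).
Local Notation C := R[i].
Implicit Types (u v : 'rV[C]_n) (A B : 'M[C]_n).

Definition vnorm v : R := complex.Re (sqrtC (dotmx v v)).

Lemma vnormE v : (vnorm v)%:C = sqrtC (dotmx v v).
Proof. by apply: RRe_real; rewrite ger0_real // sqrtC_ge0 dnorm_ge0. Qed.

Lemma vnorm_ge0 v : 0 <= vnorm v.
Proof. by rewrite -lecR vnormE sqrtC_ge0 dnorm_ge0. Qed.

Lemma sqr_vnorm v : (vnorm v ^+ 2)%:C = dotmx v v.
Proof. by rewrite rmorphXn /= vnormE sqrtCK. Qed.

Lemma vnorm_eq0 v : vnorm v = 0 -> v = 0.
Proof.
by move=> v0; apply/eqP; rewrite -(dnorm_eq0 (@dotmx R[i] n)) /= -sqr_vnorm v0 expr0n.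
Qed.

Lemma vnormD u v : vnorm (u + v) <= vnorm u + vnorm v.
Proof.
rewrite -lecR rmorphD /= !vnormE.
by have [] := triangle_lerif (@dotmx R[i] n) u v.
Qed.

Lemma vnormZ (c : C) v : vnorm (c *: v) = normc c * vnorm v.
Proof.
apply: complexI; rewrite rmorphM /= !vnormE dnormZ sqrtCM ?nnegrE ?dnorm_ge0 ?exprn_ge0 //.
by rewrite (sqrCK (normr_ge0 c)).
Qed.

Lemma dotmx_le u v : normc (dotmx u v) <= vnorm u * vnorm v.
Proof.
rewrite -lecR rmorphM /= !vnormE.
by have [] := CauchySchwarz_sqrt (@dotmx R[i] n) u v.
Qed.

Lemma dotmx_mul u v A : dotmx (u *m (map_mx (@conjc R) A)^T) v = dotmx u (v *m A).
Proof. by rewrite !dotmxE trmx_mul map_mxM map_trmx mulmxA. Qed.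

(** Cauchy-Schwarz applied to $\langle vAA^*,v\rangle=\|vA\|^2$; this is the source of the
    C*-identity for matrices. *)
Lemma vnorm_mul_sqr v A :
  vnorm (v *m A) ^+ 2 <= vnorm (v *m A *m (map_mx (@conjc R) A)^T) * vnorm v.
Proof.
apply: le_trans (dotmx_le _ _); rewrite dotmx_mul -sqr_vnorm.
by rewrite /= expr0n addr0 sqrtr_sqr ger0_norm // sqr_ge0.
Qed.

Lemma vnorm_sum (I : Type) (s : seq I) (F : I -> 'rV[C]_n) :
  vnorm (\sum_(i <- s) F i) <= \sum_(i <- s) vnorm (F i).
Proof.
elim/big_rec2: _ => [|i x v _ vx]; last exact: le_trans (vnormD _ _) (lerD _ _).
by rewrite -(scale0r (0 : 'rV_n)) vnormZ normc0 mul0r.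
Qed.

Lemma dotmx_delta v k : dotmx v (delta_mx 0 k) = v 0 k.
Proof.
rewrite dotmxE !mxE (bigD1 k) //= big1 => [|i ik]; rewrite !mxE !eqxx.
  by rewrite conjC1 mulr1 addr0.
by rewrite (negPf ik) conjC0 mulr0.
Qed.

Lemma vnorm_delta k : vnorm (delta_mx 0 k) = 1.
Proof. by apply: complexI; rewrite vnormE dotmx_delta mxE !eqxx sqrtC1. Qed.

Lemma normc_le_vnorm v k : normc (v 0 k) <= vnorm v.
Proof. by rewrite -dotmx_delta (le_trans (dotmx_le _ _)) // vnorm_delta mulr1. Qed.

(** A crude bound, which makes the supremum in [mxnorm] finite and later turns entrywise convergence
    into norm convergence. *)
Lemma vnorm_mul_bound v A :
  vnorm (v *m A) <= (\sum_i \sum_j normc (A i j)) * vnorm v.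
Proof.
rewrite mulmx_sum_row (le_trans (vnorm_sum _ _)) // mulr_suml ler_sum // => i _.
rewrite vnormZ mulrC ler_pM ?vnorm_ge0 ?normc_ge0 ?normc_le_vnorm //.
rewrite [row i A]row_sum_delta (le_trans (vnorm_sum _ _)) // ler_sum // => j _.
by rewrite vnormZ vnorm_delta mulr1 mxE.
Qed.

End VectorNorm.

(** The operator norm for the Euclidean norm, with matrices acting on row vectors from the right. *)
HB.lock Definition mxnorm (R : realType) (n : nat) (A : 'M[R[i]]_n) : R :=
  sup [set vnorm (v *m A) | v in [set v | vnorm v <= 1]]%classic.

Section MatrixNorm.
Variables (R : realType) (n : nat).
Local Notation C := R[i].
Implicit Types (u v : 'rV[C]_n) (A B : 'M[C]_n).

Lemma mxnorm_le A c : 0 <= c -> (forall v, vnorm (v *m A) <= c * vnorm v) ->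
  mxnorm A <= c.
Proof.
move=> c0 Ac; rewrite mxnorm.unlock; apply: ge_sup.
  exists (vnorm (0 *m A)), 0 => //=.
  by rewrite -(scale0r (0 : 'rV_n)) vnormZ normc0 mul0r.
move=> _ [v /= v1 <-]; apply: le_trans (Ac v) _.
by rewrite -[leRHS]mulr1 ler_wpM2l.
Qed.

Lemma vnorm_mul v A : vnorm (v *m A) <= mxnorm A * vnorm v.
Proof.
have [v0|v0] := eqVneq (vnorm v) 0.
  by rewrite (vnorm_eq0 v0) mul0mx -(scale0r (0 : 'rV_n)) vnormZ normc0 !mul0r mulr0.
have vgt0 : 0 < vnorm v by rewrite lt0r v0 vnorm_ge0.
rewrite mxnorm.unlock -ler_pdivrMr //.
have nvV : normc ((vnorm v)^-1)%:C = (vnorm v)^-1.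
  by rewrite /= expr0n addr0 sqrtr_sqr ger0_norm // invr_ge0 ltW.
have -> : vnorm (v *m A) / vnorm v = vnorm (((vnorm v)^-1)%:C *: v *m A).
  by rewrite -scalemxAl vnormZ nvV mulrC.
apply: sup_ubound; last first.
  by exists (((vnorm v)^-1)%:C *: v) => //=; rewrite vnormZ nvV mulVf.
exists (\sum_i \sum_j normc (A i j)) => _ [w /= w1 <-].
apply: le_trans (vnorm_mul_bound w A) _; rewrite -[leRHS]mulr1 ler_wpM2l //.
by do 2!apply: sumr_ge0 => ? _; exact: normc_ge0.
Qed.

Lemma mxnorm_sum A : mxnorm A <= \sum_i \sum_j normc (A i j).
Proof.
apply: mxnorm_le => [|v]; last exact: vnorm_mul_bound.
by do 2!apply: sumr_ge0 => ? _; exact: normc_ge0.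
Qed.

Lemma normc_le_mxnorm A i j : normc (A i j) <= mxnorm A.
Proof.
have := vnorm_mul (delta_mx 0 i) A; rewrite vnorm_delta mulr1; apply: le_trans.
by have <- : row i A 0 j = A i j by [rewrite mxE]; rewrite -rowE normc_le_vnorm.
Qed.
End MatrixNorm.

Section MatrixCstar.
Variables (R : realType) (n : nat).
Local Notation C := R[i].
Local Notation M := 'M[C]_n.+1.
Implicit Types A B : M.

Definition mxstar A : M := (map_mx (@conjc R) A)^T.

Lemma mxnorm_ge0 A : 0 <= mxnorm A.
Proof. exact: le_trans (normc_ge0 _) (normc_le_mxnorm A 0 0). Qed.

Fact mxstarK : involutive mxstar.
Proof. by move=> A; apply/matrixP => i j; rewrite !mxE conjcK. Qed.

Fact mxstarD : {morph mxstar : A B / A + B}.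
Proof. by move=> A B; apply/matrixP => i j; rewrite !mxE rmorphD. Qed.

Fact mxstarZ (c : C) A : mxstar (c *: A) = c^* *: mxstar A.
Proof. by apply/matrixP => i j; rewrite !mxE rmorphM. Qed.

Fact mxstarM A B : mxstar (A * B) = mxstar B * mxstar A.
Proof. by rewrite /mxstar map_mxM trmx_mul. Qed.

Fact mxnorm_eq0 A : mxnorm A = 0 -> A = 0.
Proof.
move=> A0; apply/matrixP => i j; rewrite mxE; apply: eq0_normc.
by apply/eqP; rewrite eq_le normc_ge0 -A0 normc_le_mxnorm.
Qed.

Fact mxnormD A B : mxnorm (A + B) <= mxnorm A + mxnorm B.
Proof.
apply: mxnorm_le => [|v]; first by rewrite addr_ge0 ?mxnorm_ge0.
by rewrite mulmxDr (le_trans (vnormD _ _)) // mulrDl lerD ?vnorm_mul.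
Qed.

Fact mxnormZ (c : C) A : mxnorm (c *: A) = normc c * mxnorm A.
Proof.
have le (d : C) B : mxnorm (d *: B) <= normc d * mxnorm B.
  apply: mxnorm_le => [|v]; first by rewrite mulr_ge0 ?normc_ge0 ?mxnorm_ge0.
  by rewrite -scalemxAr vnormZ -mulrA ler_wpM2l ?normc_ge0 ?vnorm_mul.
apply/eqP; rewrite eq_le le /=.
have [->|c0] := eqVneq c 0; first by rewrite normc0 mul0r mxnorm_ge0.
have nc0 : 0 < normc c.
  by rewrite lt0r normc_ge0 andbT; apply: contra c0 => /eqP/eq0_normc->.
rewrite -ler_pdivlMl // -normcV.
by have := le c^-1 (c *: A); rewrite [X in mxnorm X]scalerA [c^-1 * c]mulVf // scale1r.
Qed.

Fact mxnormM A B : mxnorm (A * B) <= mxnorm A * mxnorm B.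
Proof.
apply: mxnorm_le => [|v]; first by rewrite mulr_ge0 ?mxnorm_ge0.
rewrite -[A * B]/(A *m B) mulmxA (le_trans (vnorm_mul _ _)) //.
by rewrite mulrC mulrAC ler_wpM2r ?mxnorm_ge0 ?vnorm_mul.
Qed.

Fact mxnorm_identity A : mxnorm (mxstar A * A) = mxnorm A ^+ 2.
Proof.
(* From $\|B\|^2\le\|BB^*\|\le\|B\|\,\|B^*\|$ follows $\|B\|\le\|B^*\|$, hence equality, and then
   both halves of the identity. *)
have sq_le B : mxnorm B ^+ 2 <= mxnorm (B * mxstar B).
  rewrite -[leRHS]sqr_sqrtr ?mxnorm_ge0 // ler_pXn2r ?nnegrE ?mxnorm_ge0 ?sqrtr_ge0 //.
  apply: mxnorm_le => [|v]; first exact: sqrtr_ge0.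
  rewrite -[vnorm v](ger0_norm (vnorm_ge0 _)) -sqrtr_sqr -sqrtrM ?mxnorm_ge0 //.
  rewrite -[leLHS](ger0_norm (vnorm_ge0 _)) -sqrtr_sqr ler_sqrt; last first.
    by rewrite mulr_ge0 ?mxnorm_ge0 ?sqr_ge0.
  rewrite (le_trans (vnorm_mul_sqr v B)) // expr2 mulrA ler_wpM2r ?vnorm_ge0 //.
  by rewrite -mulmxA vnorm_mul.
have le_star B : mxnorm B <= mxnorm (mxstar B).
  have [->|B0] := eqVneq (mxnorm B) 0; first exact: mxnorm_ge0.
  have Bgt0 : 0 < mxnorm B by rewrite lt0r B0 mxnorm_ge0.
  by rewrite -(ler_pM2l Bgt0) -expr2 (le_trans (sq_le B)) // mxnormM.
have eq_star : mxnorm (mxstar A) = mxnorm A.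
  by apply/eqP; rewrite eq_le le_star andbT -[A in leRHS]mxstarK le_star.
apply/eqP; rewrite eq_le; apply/andP; split.
  by rewrite (le_trans (mxnormM _ _)) // eq_star.
by have := sq_le (mxstar A); rewrite mxstarK eq_star.
Qed.

Fact mxnorm_complete (s : nat -> M) :
  (forall e : R, 0 < e -> exists n0, forall k m, (n0 <= k)%N -> (n0 <= m)%N ->
     mxnorm (s k - s m) < e) ->
  exists l, forall e : R, 0 < e ->
    exists n0, forall k, (n0 <= k)%N -> mxnorm (s k - l) < e.
Proof.
move=> sC.
have entry i j : exists l : C, forall e : R, 0 < e ->
    exists n0, forall k, (n0 <= k)%N -> normc (s k i j - l) < e.
  apply: (@cplx_complete R (fun k => s k i j)) => e /sC[n0 Hn0]; exists n0 => k m hk hm.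
  apply: le_lt_trans (Hn0 k m hk hm).
  by have := normc_le_mxnorm (s k - s m) i j; rewrite !mxE.
have /choice[l Hl] : forall ij : 'I_n.+1 * 'I_n.+1, exists l : C, forall e : R, 0 < e ->
    exists n0, forall k, (n0 <= k)%N -> normc (s k ij.1 ij.2 - l) < e.
  by case=> i j; exact: entry.
exists (\matrix_(i, j) l (i, j)) => e e0.
(* The $(n+1)^2$ entries, each within [d], add up to at most [e / 2], which leaves the inequality
   strict. *)
pose d := e / (n.+1 * n.+1)%:R / 2.
have d0 : 0 < d by rewrite !divr_gt0 // ltr0n.
have /choice[n0 Hn0] : forall ij, exists n0, forall k, (n0 <= k)%N ->
    normc (s k ij.1 ij.2 - l ij) < d by move=> ij; exact: Hl.
exists (\max_ij n0 ij) => k hk; apply: le_lt_trans (mxnorm_sum _) _.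
apply: (@le_lt_trans _ _ (\sum_(i < n.+1) \sum_(j < n.+1) d)).
  do 2!apply: ler_sum => ? _; rewrite !mxE ltW //.
  apply: (Hn0 (_, _)); apply: leq_trans hk; exact: leq_bigmax.
rewrite !sumr_const !card_ord -mulrnA -mulr_natr /d.
by rewrite mulrAC divfK ?pnatr_eq0 // ltr_pdivrMr // ltr_pMr // ltr1n.
Qed.

HB.instance Definition _ := isCstarAlgebra.Build R M
  mxstarK mxstarD mxstarZ mxstarM mxnorm_eq0 mxnormD mxnormZ mxnormM
  mxnorm_identity mxnorm_complete.
End MatrixCstar.

(** * Star morphisms and tensor products with matrices *)

Section CstarBasics.
Variables (R : realType) (A : cstarType R).
Implicit Types x y : A.

Lemma cnormN x : cnorm (- x) = cnorm x.
Proof. by rewrite -scaleN1r cnormZ normcN normc1 mul1r. Qed.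

Lemma star0 : star (0 : A) = 0.
Proof. by rewrite -[X in star X](scale0r (0 : A)) starZ rmorph0 scale0r. Qed.

Lemma star1 : star (1 : A) = 1.
Proof. by rewrite -[LHS]mulr1 -[X in _ * X](starK (1 : A)) -starM mulr1 starK. Qed.

Lemma star_sum (I : Type) (s : seq I) (F : I -> A) :
  star (\sum_(i <- s) F i) = \sum_(i <- s) star (F i).
Proof. exact: (big_morph _ (@starD R A) star0). Qed.

Lemma cstar_eq0 x : star x * x = 0 -> x = 0.
Proof.
move=> xx0; apply/cnorm_eq0/eqP; rewrite -sqrf_eq0 -cstar_identity xx0.
by rewrite -(scale0r (0 : A)) cnormZ normc0 mul0r.
Qed.
End CstarBasics.

Section StarMorphisms.
Variables (R : realType) (A B C : cstarType R).

Section Comp.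
Variables (g : starMorphism B C) (f : starMorphism A B).
Fact comp_smorph_star : {morph (g \o f) : x / star x}.
Proof. by move=> x; rewrite /= !smorph_star. Qed.
Fact comp_smorph_contr x : cnorm ((g \o f) x) <= cnorm x.
Proof. exact: le_trans (smorph_contr (f x)) (smorph_contr x). Qed.
HB.instance Definition _ := isStarMorphism.Build R A C (g \o f)
  comp_smorph_star comp_smorph_contr.
Definition comp_star : starMorphism A C := g \o f.
End Comp.

(** The set where [f] and [g] agree is a C*-subalgebra; it is norm closed because both maps are
    contractive. *)
Lemma eq_on_generators (E : A -> Prop) (f g : starMorphism A B) :
  generates E -> (forall x, E x -> f x = g x) -> f =1 g.
Proof.
move=> genE fgE; apply: genE => //; split=> //.
- by rewrite !rmorph1.
- by move=> x y fx fy; rewrite !rmorphD /= fx fy.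
- by move=> c x fx; rewrite !linearZ /= fx.
- by move=> x y fx fy; rewrite !rmorphM /= fx fy.
- by move=> x fx; rewrite !smorph_star fx.
move=> s l fs sl; apply/subr0_eq/cnorm_eq0/eqP; rewrite eq_le cnorm_ge0 andbT.
apply/ler_addgt0Pr => e e0; rewrite add0r.
have [n /(_ n (leqnn n)) sn] := sl (e / 2) (divr_gt0 e0 (ltr0n _ 2)).
have -> : f l - g l = - f (s n - l) + g (s n - l).
  by rewrite !rmorphB /= fs opprB addrA subrK.
rewrite (le_trans (cnormD _ _)) // cnormN [leRHS]splitr.
by rewrite lerD // (le_trans (smorph_contr _)) // ltW.
Qed.
End StarMorphisms.

Definition mx_cstar (R : realType) (n : nat) : cstarType R := 'M[R[i]]_n.+1.

(* Identifies 'M[A]_n with a subring of the tensor product of A and M_n(C), so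
   that ring identities between elements of A (x) M_n(C) can be read off
   entrywise. *)
Section TensorMatrix.
Variables (R : realType) (n : nat) (A : cstarType R).
Local Notation M := (mx_cstar R n).
Variable (T : tensor_product A M).

Definition tens_mx (Z : 'M[A]_n.+1) : T :=
  \sum_(rs : 'I_n.+1 * 'I_n.+1) tinl T (Z rs.1 rs.2) * tinr T (delta_mx rs.1 rs.2 : M).

Lemma tens_mx_inj Z W : tens_mx Z = tens_mx W -> Z = W.
Proof.
move/eqP; rewrite -subr_eq0 -sumrB => /eqP ZW0.
(* The matrix units, enumerated by an ordinal as [tens_inj] requires; their linear independence
   separates the entries. *)
pose b (k : 'I_#|{: 'I_n.+1 * 'I_n.+1}|) : M :=
  delta_mx (enum_val k).1 (enum_val k).2.
have indep : lin_indep b.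
  move=> c /matrixP c0 k; have := c0 (enum_val k).1 (enum_val k).2.
  rewrite summxE (bigD1 k) //= big1 => [|l lk]; rewrite !mxE ?eqxx.
    by rewrite mulr1 addr0.
  case: eqP => [e1|_]; last by rewrite mulr0.
  case: eqP => [e2|_]; last by rewrite mulr0.
  case/eqP: lk; apply: enum_val_inj.
  by rewrite [LHS]surjective_pairing -e1 -e2 -surjective_pairing.
apply/matrixP => r s; apply/subr0_eq.
have /(_ _)/(_ (enum_rank (r, s))) := tens_inj (t := T)
  (a := fun k => Z (enum_val k).1 (enum_val k).2 - W (enum_val k).1 (enum_val k).2) indep.
rewrite enum_rankK; apply; rewrite -[RHS]ZW0.
rewrite [RHS](reindex _ (onW_bij _ (enum_val_bij _))) /=.
by apply: eq_bigr => k _; rewrite rmorphB mulrBl.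
Qed.

Lemma tens_mxM Z W : tens_mx (Z *m W) = tens_mx Z * tens_mx W.
Proof.
rewrite /tens_mx -!(pair_bigA _ (fun r s => tinl T (_ r s) * tinr T (delta_mx r s : M))) /=.
rewrite mulr_suml; apply: eq_bigr => r _.
under eq_bigr => s _ do rewrite mxE rmorph_sum mulr_suml.
rewrite exchange_big mulr_suml; apply: eq_bigr => k _ /=.
rewrite mulr_sumr [RHS](bigD1 k) //= [X in _ + X]big1 ?addr0 => [|k' kk']; last first.
  rewrite mulr_sumr big1 // => s _.
  rewrite mulrA -[_ * tinr T _ * _]mulrA -tens_comm mulrA -mulrA -!rmorphM.
  by rewrite [delta_mx _ _ * _]mul_delta_mx_cond eq_sym (negPf kk') mulr0n rmorph0 mulr0.
rewrite mulr_sumr; apply: eq_bigr => s _.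
rewrite mulrA -[_ * tinr T _ * _]mulrA -tens_comm mulrA -mulrA -!rmorphM.
by rewrite [delta_mx _ _ * _]mul_delta_mx.
Qed.

Lemma tens_mxE (I : finType) (a : I -> A) (m : I -> M) :
  \sum_i tinl T (a i) * tinr T (m i) =
  tens_mx (\matrix_(r, s) \sum_i m i r s *: a i).
Proof.
rewrite /tens_mx.
under [RHS]eq_bigr => rs _ do rewrite mxE rmorph_sum mulr_suml.
rewrite exchange_big; apply: eq_bigr => i _ /=.
rewrite {1}[m i]matrix_sum_delta pair_bigA /= rmorph_sum mulr_sumr.
apply: eq_bigr => rs _; rewrite linearZ /= -scalerAl scalerAr; congr (_ * _).
exact: linearZ_LR.
Qed.
End TensorMatrix.

(** * Representations of the spheres by involutions *)

(* A table of involutions of {0, ..., n}: the k-th row lists the values of the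
   k-th involution. *)
Definition tab_fun (tab : seq (seq nat)) (l r : nat) : nat := nth 0%N (nth [::] tab l) r.

Definition involution_table (n : nat) (tab : seq (seq nat)) : bool :=
  all (fun l => all (fun r => (tab_fun tab l r <= n)%N &&
                     (tab_fun tab l (tab_fun tab l r) == r)) (iota 0 n.+1))
      (iota 0 (size tab)).

(** The relation $abc=cba$ for the involutions of the table, in boolean form so that concrete tables
    are checked by computation. *)
Definition half_table (n : nat) (tab : seq (seq nat)) : bool :=
  let f := tab_fun tab in let ls := iota 0 (size tab) in
  all (fun l => all (fun m => all (fun q => all (fun r =>
    f q (f m (f l r)) == f l (f m (f q r))) (iota 0 n.+1)) ls) ls) ls.

Section Model.
Variables (R : realType) (n N : nat) (tab : seq (seq nat)) (S : seq 'I_N).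
Hypotheses (tabP : involution_table n tab) (S0 : (0 < size S)%N).
Hypotheses (Stab : size S = size tab) (uS : uniq S).
Local Notation f := (tab_fun tab).
Local Notation M := (mx_cstar R n).

Lemma tab_fun_le l r : (l < size tab)%N -> (r <= n)%N -> (f l r <= n)%N.
Proof.
move=> lk rn; move/allP: tabP => /(_ l); rewrite mem_iota lk => /(_ isT)/allP/(_ r).
by rewrite mem_iota ltnS rn => /(_ isT)/andP[].
Qed.

Lemma tab_funK l r : (l < size tab)%N -> (r <= n)%N -> f l (f l r) = r.
Proof.
move=> lk rn; move/allP: tabP => /(_ l); rewrite mem_iota lk => /(_ isT)/allP/(_ r).
by rewrite mem_iota ltnS rn => /(_ isT)/andP[_ /eqP].
Qed.

Definition tab_mx l : M := \matrix_(r, s) (f l r == s :> nat)%:R.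

Lemma tab_mx_mulE l (Z : M) r s : (l < size tab)%N ->
  (tab_mx l * Z) r s = Z (inord (f l r)) s.
Proof.
move=> lk; have fr : (f l r < n.+1)%N by rewrite ltnS tab_fun_le ?leq_ord.
rewrite [LHS]mxE (bigD1 (inord (f l r))) //= big1 => [|t tf].
  by rewrite mxE inordK // eqxx mul1r addr0.
rewrite mxE; case: eqP => [e|_]; last by rewrite mul0r.
by rewrite e inord_val eqxx in tf.
Qed.

Lemma tab_mx_sq l : (l < size tab)%N -> tab_mx l * tab_mx l = 1.
Proof.
move=> lk; apply/matrixP => r s; rewrite tab_mx_mulE // !mxE.
by rewrite inordK ?ltnS ?tab_funK ?tab_fun_le ?leq_ord.
Qed.

Lemma tab_mx_star l : (l < size tab)%N -> star (tab_mx l) = tab_mx l.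
Proof.
move=> lk; apply/matrixP => r s; rewrite !mxE rmorph_nat; congr ((nat_of_bool _)%:R : R[i]).
by apply/eqP/eqP => <-; rewrite tab_funK ?leq_ord.
Qed.

Lemma tab_mx_half l m q : half_table n tab ->
  (l < size tab)%N -> (m < size tab)%N -> (q < size tab)%N ->
  tab_mx l * tab_mx m * tab_mx q = tab_mx q * tab_mx m * tab_mx l.
Proof.
move=> + lk mk qk => /allP/(_ l); rewrite mem_iota lk => /(_ isT)/allP/(_ m).
rewrite mem_iota mk => /(_ isT)/allP/(_ q); rewrite mem_iota qk => /(_ isT)/allP half.
apply/matrixP => r s; rewrite -!mulrA !tab_mx_mulE // !mxE.
have rn : (r < n.+1)%N by [].
have := half r; rewrite mem_iota rn => /(_ isT)/eqP half_r.
by rewrite !inordK ?half_r ?ltnS ?tab_fun_le ?leq_ord.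
Qed.

Definition model_scale : R[i] := ((Num.sqrt (size S)%:R)^-1)%:C.

Lemma model_scale_sq : model_scale ^+ 2 *+ size S = 1.
Proof.
rewrite -rmorphXn -rmorphMn exprVn sqr_sqrtr ?ler0n // -mulr_natr mulVf ?rmorph1 //.
by rewrite pnatr_eq0 -lt0n.
Qed.

Lemma model_scale_neq0 : model_scale != 0.
Proof.
apply/eqP => c0; have := model_scale_sq; rewrite c0 expr0n mul0rn => /eqP.
by rewrite eq_sym oner_eq0.
Qed.

Definition model_coord (d : 'I_N) : M :=
  if d \in S then model_scale *: tab_mx (index d S) else 0.

(** The square is scalar, hence central: every table of involutions represents $S^{N-1}_{\mathbb
    R,\infty}$. *)
Lemma model_coord_sq d :
  model_coord d ^+ 2 = (if d \in S then model_scale ^+ 2 else 0) *: 1.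
Proof.
rewrite /model_coord; case: ifP => dS; last by rewrite expr0n scale0r.
by rewrite expr2 -scalerAl -scalerAr scalerA -expr2 tab_mx_sq // -Stab index_mem.
Qed.

Lemma model_coords : sphere_coords model_coord.
Proof.
split=> [d|].
  rewrite /model_coord; case: ifP => dS; last exact: star0.
  by rewrite starZ tab_mx_star -?Stab ?index_mem //; congr (_ *: _); exact: conjc_real.
under eq_bigr => d _ do rewrite model_coord_sq.
rewrite -scaler_suml -big_mkcond -big_uniq //= big_const_seq.
by rewrite count_predT -Monoid.iteropE /= [X in X *: _]model_scale_sq scale1r.
Qed.
End Model.

Lemma tens_mx1 (R : realType) (n : nat) (A : cstarType R)
    (T : tensor_product A (mx_cstar R n)) : tens_mx T 1%:M = 1.
Proof.
have := tens_mxE T (fun _ : 'I_1 => 1) (fun _ => 1); rewrite big_ord1 !rmorph1 mulr1 => ->.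
congr tens_mx; apply/matrixP => r s; rewrite !mxE big_ord1 /=.
by case: (r == s); rewrite ?scale1r ?scale0r.
Qed.

(* Sum of the products u i_1 (S l_1) ... u i_k (S l_k) over all words l_1 ... l_k
   whose involutions, the first letter acting first, send r to s. *)
Fixpoint word_sum (A : pzRingType) (N : nat) (u : 'I_N -> 'I_N -> A) (tab : seq (seq nat))
    (S : nat -> 'I_N) (w : seq 'I_N) (r s : nat) : A :=
  if w is i :: w' then
    \sum_(0 <= l < size tab) u i (S l) * word_sum u tab S w' (tab_fun tab l r) s
  else if r == s then 1 else 0.

(** * Transfer of relations between sphere coordinates to words in the entries of [u] *)

Section Transfer.
Variables (R : realType) (T : tensor_functor R) (N : nat).
Variables (G : quantum_subgroup T N) (X : sphere_subset R N).
Hypothesis GX : acts_affinely G X.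
Variables (n : nat) (tab : seq (seq nat)) (S : seq 'I_N) (a0 : 'I_N).
Hypotheses (tabP : involution_table n tab) (S0 : (0 < size S)%N).
Hypotheses (Stab : size S = size tab) (uS : uniq S).
Local Notation M := (mx_cstar R n).
Local Notation u := (umx G).
Variable psi : starMorphism X M.
Hypothesis psiE : forall a, psi (coord X a) = model_coord R n tab S a.

(** The image of $\sum_a u_{ia}\otimes x_a$ when the $x_a$ are evaluated in the model. *)
Definition action_mx i : 'M[G]_n.+1 :=
  \matrix_(r, s) \sum_a model_coord R n tab S a r s *: u i a.

Lemma action_mxE : exists chi : starMorphism X (T G M),
  forall i, chi (coord X i) = tens_mx (T G M) (action_mx i).
Proof.
have [Phi _ PhiE] := GX; exists (comp_star (tmap T (id_star G) psi) Phi) => i /=.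
rewrite PhiE rmorph_sum -tens_mxE; apply: eq_bigr => a _.
by rewrite rmorphM /= tmap_inl tmap_inr psiE.
Qed.

Lemma action_mx_entry i r s : action_mx i r s =
  model_scale R S *:
  \sum_(0 <= l < size tab | tab_fun tab l r == s :> nat) u i (nth a0 S l).
Proof.
rewrite mxE (eq_bigr (fun a => (if a \in S then
    (model_scale R S * (tab_fun tab (index a S) r == s :> nat)%:R) else 0) *: u i a)).
  rewrite (bigID (mem S)) /= [X in _ + X]big1 ?addr0 => [|a /negPf->]; last first.
    by rewrite scale0r.
  rewrite scaler_sumr -big_uniq //= (big_nth a0) Stab [RHS]big_mkcond.
  apply: congr_big_nat => // l /=; rewrite -Stab => lS.
  rewrite mem_nth // index_uniq //; case: eqP => _; first by rewrite mulr1.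
  by rewrite mulr0 scale0r.
move=> a _; rewrite /model_coord; case: ifP => // _; first by rewrite !mxE.
by rewrite mxE.
Qed.

Lemma action_mx_mulE i (Z : 'M[G]_n.+1) r s : (action_mx i *m Z) r s =
  model_scale R S *:
  \sum_(0 <= l < size tab) u i (nth a0 S l) * Z (inord (tab_fun tab l r)) s.
Proof.
rewrite mxE.
under eq_bigr => t _ do rewrite action_mx_entry -scalerAl big_mkcond mulr_suml.
rewrite -scaler_sumr exchange_big; congr (_ *: _); apply: eq_big_nat => l lk /=.
have fr : (tab_fun tab l r < n.+1)%N by rewrite ltnS tab_fun_le ?leq_ord.
rewrite (bigD1 (inord (tab_fun tab l r))) //= inordK // eqxx big1 ?addr0 // => t tf.
case: eqP => [e|_]; last by rewrite mul0r.
by rewrite e inord_val eqxx in tf.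
Qed.

(** The entry sums over paths from [r] to [s], each step applying one involution of the table; every
    letter contributes one factor [model_scale]. *)
Lemma action_mx_word w r s :
  (\big[mulmx/1%:M]_(i <- w) action_mx i) r s =
  model_scale R S ^+ size w *: word_sum u tab (nth a0 S) w r s.
Proof.
elim: w r => [|i w IHw] r.
  by rewrite big_nil mxE expr0 scale1r /= val_eqE; case: eqP.
rewrite big_cons action_mx_mulE exprS -scalerA /=; congr (_ *: _).
rewrite scaler_sumr; apply: eq_big_nat => l lk; rewrite IHw -scalerAr inordK //.
by rewrite ltnS tab_fun_le ?leq_ord.
Qed.

(** The action followed by the model carries the relation into matrices over [G], where it is read
    entrywise. As both words have the same length, the powers of [model_scale] cancel. *)
Lemma word_transfer w w' : size w = size w' ->
  \prod_(i <- w) coord X i = \prod_(i <- w') coord X i ->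
  forall r s, (r <= n)%N -> (s <= n)%N ->
  word_sum u tab (nth a0 S) w r s = word_sum u tab (nth a0 S) w' r s.
Proof.
move=> sw ww' r s rn sn.
have [chi chiE] := action_mxE.
have chi_prod v : chi (\prod_(i <- v) coord X i) =
    tens_mx (T G M) (\big[mulmx/1%:M]_(i <- v) action_mx i).
  elim: v => [|i v IHv]; first by rewrite !big_nil rmorph1 tens_mx1.
  by rewrite !big_cons rmorphM /= chiE IHv tens_mxM.
have := congr1 chi ww'; rewrite !chi_prod.
move=> /tens_mx_inj/matrixP/(_ (inord r) (inord s)).
rewrite !action_mx_word !inordK ?ltnS // -sw => /scalerI; apply.
exact/expf_neq0/model_scale_neq0.
Qed.

End Transfer.

(** * Quantum group structures and actions *)

Lemma orthogonal_mxP (R : realType) (N : nat) (A : cstarType R) (u : 'M[A]_N) :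
  orthogonal_mx u <->
  [/\ forall i j, star (u i j) = u i j,
      forall i j, \sum_k u i k * u j k = (i == j)%:R &
      forall i j, \sum_k u k i * u k j = (i == j)%:R].
Proof.
split=> -[us ur uc]; split=> //.
- by move=> i j; have /matrixP/(_ i j) := ur; rewrite !mxE => <-;
    apply: eq_bigr => k _; rewrite mxE.
- by move=> i j; have /matrixP/(_ i j) := uc; rewrite !mxE => <-;
    apply: eq_bigr => k _; rewrite mxE.
- by apply/matrixP => i j; rewrite !mxE -ur; apply: eq_bigr => k _; rewrite mxE.
- by apply/matrixP => i j; rewrite !mxE -uc; apply: eq_bigr => k _; rewrite mxE.
Qed.

Section TensorSums.
Variables (R : realType) (A B : cstarType R) (T : tensor_product A B) (N : nat).
Implicit Types (a c e : 'I_N -> A) (b d f : 'I_N -> B).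

(** With a row of [u] on the left, this is the common shape of $\Delta(u_{ij})$ and of
    $\Phi(x_i)$. *)
Definition tens_sum a b : T := \sum_k tinl T (a k) * tinr T (b k).

Lemma tens_mulE (x y : A) (z w : B) :
  tinl T x * tinr T z * (tinl T y * tinr T w) = tinl T (x * y) * tinr T (z * w).
Proof.
by rewrite !rmorphM /= -!mulrA; congr (_ * _); rewrite !mulrA tens_comm.
Qed.

Lemma tens_sum_star a b : (forall k, star (a k) = a k) -> (forall k, star (b k) = b k) ->
  star (tens_sum a b) = tens_sum a b.
Proof.
move=> sa sb; rewrite star_sum; apply: eq_bigr => k _.
by rewrite starM -!smorph_star sa sb tens_comm.
Qed.

Lemma tens_sum_mul2 a b c d : tens_sum a b * tens_sum c d =
  \sum_k \sum_l tinl T (a k * c l) * tinr T (b k * d l).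
Proof.
rewrite mulr_suml; apply: eq_bigr => k _; rewrite mulr_sumr.
by apply: eq_bigr => l _; rewrite tens_mulE.
Qed.

Lemma tens_sum_mul3 a b c d e f : tens_sum a b * tens_sum c d * tens_sum e f =
  \sum_k \sum_l \sum_m tinl T (a k * c l * e m) * tinr T (b k * d l * f m).
Proof.
rewrite tens_sum_mul2 mulr_suml; apply: eq_bigr => k _; rewrite mulr_suml.
apply: eq_bigr => l _; rewrite mulr_sumr.
by apply: eq_bigr => m _; rewrite tens_mulE.
Qed.

Lemma tens_sum_orthl (g h : 'I_N -> 'I_N -> A) b d :
  (forall k l, \sum_i g i k * h i l = (k == l)%:R) ->
  \sum_i tens_sum (g i) b * tens_sum (h i) d = \sum_k tinr T (b k * d k).
Proof.
move=> gh; under eq_bigr => i _ do rewrite tens_sum_mul2.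
rewrite exchange_big; apply: eq_bigr => k _; rewrite exchange_big /=.
under eq_bigr => l _ do rewrite -mulr_suml -rmorph_sum gh.
rewrite (bigD1 k) //= big1 => [|l lk]; first by rewrite eqxx rmorph1 mul1r addr0.
by rewrite eq_sym (negPf lk) rmorph0 mul0r.
Qed.

Lemma tens_sum_orthr a c (g h : 'I_N -> 'I_N -> B) :
  (forall k l, \sum_i g i k * h i l = (k == l)%:R) ->
  \sum_i tens_sum a (g i) * tens_sum c (h i) = \sum_k tinl T (a k * c k).
Proof.
move=> gh; under eq_bigr => i _ do rewrite tens_sum_mul2.
rewrite exchange_big; apply: eq_bigr => k _; rewrite exchange_big /=.
under eq_bigr => l _ do rewrite -mulr_sumr -rmorph_sum gh.
rewrite (bigD1 k) //= big1 => [|l lk]; first by rewrite eqxx rmorph1 mulr1 addr0.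
by rewrite eq_sym (negPf lk) rmorph0 mulr0.
Qed.

Lemma tens_sum_comm a b c d :
  (forall k l, a k * c l = c l * a k) -> (forall k l, b k * d l = d l * b k) ->
  tens_sum a b * tens_sum c d = tens_sum c d * tens_sum a b.
Proof.
move=> ac bd; rewrite !tens_sum_mul2 exchange_big.
by do 2!apply: eq_bigr => ? _; rewrite ac bd.
Qed.

Lemma tens_sum_half a b c d e f :
  (forall k l m, a k * c l * e m = e m * c l * a k) ->
  (forall k l m, b k * d l * f m = f m * d l * b k) ->
  tens_sum a b * tens_sum c d * tens_sum e f = tens_sum e f * tens_sum c d * tens_sum a b.
Proof.
move=> ace bdf; rewrite !tens_sum_mul3 exchange_big.
under eq_bigr => l _ do rewrite exchange_big.
rewrite exchange_big; apply: eq_bigr => m _.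
by do 2!apply: eq_bigr => ? _; rewrite ace bdf.
Qed.

Lemma tens_sum_sq a b : (forall k l, k != l -> a k * a l = 0) ->
  tens_sum a b ^+ 2 = tens_sum (fun k => a k ^+ 2) (fun k => b k ^+ 2).
Proof.
move=> aa; rewrite expr2 tens_sum_mul2; apply: eq_bigr => k _.
rewrite (bigD1 k) //= big1 ?addr0 // => l lk.
by rewrite aa ?rmorph0 ?mul0r // eq_sym.
Qed.
End TensorSums.

Section Coactions.
Variables (R : realType) (T : tensor_functor R) (N : nat).

Lemma comult_orthogonal (A B : cstarType R) (TAB : tensor_product A B)
    (u : 'M[A]_N) (v : 'M[B]_N) : orthogonal_mx u -> orthogonal_mx v ->
  orthogonal_mx (\matrix_(i, j) tens_sum TAB (u i) (v ^~ j)).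
Proof.
move=> /orthogonal_mxP[us ur uc] /orthogonal_mxP[vs vr vc].
apply/orthogonal_mxP; split=> i j; rewrite ?mxE ?tens_sum_star //;
    under eq_bigr => k _ do rewrite !mxE.
  by rewrite tens_sum_orthr // -rmorph_sum ur rmorph_nat.
by rewrite tens_sum_orthl // -rmorph_sum vc rmorph_nat.
Qed.

Lemma action_coords (A B : cstarType R) (TAB : tensor_product A B)
    (u : 'M[A]_N) (x : 'I_N -> B) : orthogonal_mx u -> sphere_coords x ->
  sphere_coords (fun i => tens_sum TAB (u i) x).
Proof.
move=> /orthogonal_mxP[us ur uc] [xs x1]; split=> [i|]; first exact: tens_sum_star.
under eq_bigr => i _ do rewrite expr2.
rewrite tens_sum_orthl //; by rewrite -rmorph_sum -[RHS](rmorph1 (tinr TAB)) -x1.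
Qed.

(** The universal property yields comultiplication, counit and antipode once the relations hold for
    $\sum_k u_{ik}\otimes u_{kj}$, for the identity matrix, and for the transpose over the opposite
    algebra. *)
Lemma quantum_group_of_relation (P : oplus_relation R N) (Q : oplus_subset R N) :
  oplus_defined_by P Q ->
  P (T Q Q) (\matrix_(i, j) tens_sum (T Q Q) (umx Q i) (fun k => umx Q k j)) ->
  P R[i]^o 1%:M ->
  P (cstar_op Q) (\matrix_(i, j) umx Q j i) ->
  exists s : quantum_group_structure T Q, True.
Proof.
move=> [_ univ] Pcomult Pcounit Pantipode.
have uO := umxP Q; have /orthogonal_mxP[us ur uc] := uO.
have [D DE] := univ _ _ (comult_orthogonal (T Q Q) uO uO) Pcomult.
have [e eE] : exists f : starMorphism Q R[i]^o,
    forall i j, f (umx Q i j) = (1%:M : 'M[R[i]^o]_N) i j.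
  apply: univ => //; split=> [i j||]; rewrite ?trmx1 ?mulmx1 //.
  by rewrite mxE; case: eqP => _; rewrite ?star1 ?star0.
have [S SE] : exists f : starMorphism Q (cstar_op Q),
    forall i j, f (umx Q i j) = (\matrix_(i, j) umx Q j i : 'M[cstar_op Q]_N) i j.
  (* Products are reversed in the opposite algebra, so row orthogonality of the transpose is column
     orthogonality of [umx Q] with [i] and [j] exchanged, and conversely. *)
  apply: univ => //; apply/orthogonal_mxP; split=> i j.
  - by rewrite mxE; apply: us.
  - by under eq_bigr => k _ do rewrite !mxE; rewrite eq_sym; exact: uc.
  - by under eq_bigr => k _ do rewrite !mxE; rewrite eq_sym; exact: ur.
by exists (@QuantumGroupStructure _ T _ Q D (fun i j => etrans (DE i j) (mxE _ _ _ _))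
  e (fun i j => etrans (eE i j) (mxE _ _ _ _))
  S (fun i j => etrans (SE i j) (mxE _ _ _ _))).
Qed.

(** Both coaction axioms equate star morphisms, so it suffices to compare them on the
    coordinates. *)
Lemma acts_of_morphism (G : quantum_subgroup T N) (X : sphere_subset R N)
    (Phi : starMorphism X (T G X)) :
  (forall i, Phi (coord X i) = tens_sum (T G X) (umx G i) (coord X)) ->
  acts_affinely G X.
Proof.
move=> PhiE.
have coassoc : comp_star (comp_star (tassoc T G G X) (tmap T (id_star G) Phi)) Phi =1
    comp_star (tmap T (comult (qstr G)) (id_star X)) Phi.
  apply: (eq_on_generators (@coord_gen _ _ X)) => _ [i ->].
  rewrite /= !PhiE /tens_sum !rmorph_sum /=.
  under eq_bigr => j _.
    rewrite !rmorphM /= tmap_inl tmap_inr PhiE tassoc_1 /tens_sum !rmorph_sum mulr_sumr /=.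
    under eq_bigr => k _ do rewrite !rmorphM /= tassoc_2 tassoc_3 mulrA -rmorphM /=.
    over.
  rewrite exchange_big; apply: eq_bigr => k _ /=.
  rewrite rmorphM /= tmap_inl tmap_inr comultE rmorph_sum mulr_suml.
  by apply: eq_bigr.
have counital : comp_star (tmap T (counit (qstr G)) (id_star X)) Phi =1 tinr (T R[i]^o X).
  apply: (eq_on_generators (@coord_gen _ _ X)) => _ [i ->].
  rewrite /= PhiE /tens_sum rmorph_sum (bigD1 i) //= big1 => [|j ji].
    by rewrite rmorphM /= tmap_inl tmap_inr counitE eqxx rmorph1 mul1r addr0.
  by rewrite rmorphM /= tmap_inl counitE eq_sym (negPf ji) rmorph0 mul0r.
by exists Phi.
Qed.

Lemma acts_of_relations (P : oplus_relation R N) (P' : sphere_relation R N)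
    (Q : oplus_subset R N) (X : sphere_subset R N) :
  oplus_defined_by P Q -> sphere_defined_by P' X ->
  P (T Q Q) (\matrix_(i, j) tens_sum (T Q Q) (umx Q i) (fun k => umx Q k j)) ->
  P R[i]^o 1%:M ->
  P (cstar_op Q) (\matrix_(i, j) umx Q j i) ->
  P' (T Q X) (fun i => tens_sum (T Q X) (umx Q i) (coord X)) ->
  exists s : quantum_group_structure T Q, acts_affinely (QuantumSubgroup s) X.
Proof.
move=> QP [_ Xuniv] Pcomult Pcounit Pantipode P'action.
have [s _] := quantum_group_of_relation QP Pcomult Pcounit Pantipode; exists s.
have [Phi PhiE] := Xuniv _ _ (action_coords (T Q X) (umxP Q) (coordP X)) P'action.
exact: (@acts_of_morphism (QuantumSubgroup s) X Phi).
Qed.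

Lemma real_action (X : sphere_subset R N) (Q : oplus_subset R N) :
  is_real_sphere X -> is_O Q ->
  exists s : quantum_group_structure T Q, acts_affinely (QuantumSubgroup s) X.
Proof.
move=> XP QP; have [xC _] := XP; have [uC _] := QP.
apply: (acts_of_relations QP XP).
- by move=> i j k l; rewrite !mxE; apply: tens_sum_comm.
- by move=> i j k l; rewrite mulrC.
- by move=> i j k l; rewrite !mxE; apply: uC.
- by move=> i j; apply: tens_sum_comm.
Qed.

Lemma half_action (X : sphere_subset R N) (Q : oplus_subset R N) :
  is_half_liberated_sphere X -> is_Ostar Q ->
  exists s : quantum_group_structure T Q, acts_affinely (QuantumSubgroup s) X.
Proof.
move=> XP QP; have [xC _] := XP; have [uC _] := QP.
apply: (acts_of_relations QP XP).
- by move=> i j k l p q; rewrite !mxE; apply: tens_sum_half.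
- by move=> i j k l p q; rewrite mulrC mulrA mulrAC.
- move=> i j k l p q; have e := uC q p l k j i; rewrite -!mulrA in e.
  by rewrite !mxE; exact: e.
- by move=> i j k; apply: tens_sum_half.
Qed.

Section Hinfty.
Variables (A : cstarType R) (u : 'M[A]_N).
Hypotheses (us : forall i j, star (u i j) = u i j).
Hypotheses (ur : forall i j, \sum_k u i k * u j k = (i == j)%:R).
Hypothesis uH : forall i j k l p q, (i, j) != (p, q) -> (i == p) || (j == q) ->
  u i j * u k l * u p q = 0.

(** For $x=u_{ij}u_{pq}$ the product $x^*x$ begins with $u_{pq}u_{ij}u_{ij}$, which is zero by the
    defining relation. *)
Lemma Hinfty_mul0 i j p q : (i, j) != (p, q) -> (i == p) || (j == q) ->
  u i j * u p q = 0.
Proof.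
move=> ne eq1; apply: cstar_eq0; rewrite starM !us mulrA.
have -> : u p q * u i j * u i j = 0.
  by apply: uH; [rewrite eq_sym | rewrite eq_sym (eq_sym q)].
by rewrite mul0r.
Qed.

(** Inserting $1=\sum_a u_{ia}^2$ on the right of the left-hand side, or on the left of the
    right-hand side, leaves only $a=j$; both sides become $u_{ij}^2u_{kl}u_{ij}^2$. *)
Lemma Hinfty_central i j k l : u i j ^+ 2 * u k l = u k l * u i j ^+ 2.
Proof.
have sum1 : 1 = \sum_a u i a * u i a by rewrite ur eqxx.
have mid x y z : x * x * y * (z * z) = x * (x * y * z) * z by rewrite !mulrA.
have off a b : a != b -> u i a * u k l * u i b = 0.
  by move=> ab; rewrite uH ?eqxx // xpair_eqE eqxx.
transitivity (u i j ^+ 2 * u k l * u i j ^+ 2).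
  rewrite -[LHS]mulr1 sum1 mulr_sumr (bigD1 j) //= big1 ?addr0 -?expr2 // => a aj.
  by rewrite mid off ?mulr0 ?mul0r // eq_sym.
rewrite -[RHS]mul1r sum1 mulr_suml [RHS](bigD1 j) //= [X in _ + X]big1 ?addr0 => [|a aj].
  by rewrite -expr2 mulrA.
by rewrite mulrA mid off ?mulr0 ?mul0r.
Qed.
End Hinfty.

Lemma infinity_action (X : sphere_subset R N) (Q : oplus_subset R N) :
  is_infinity_sphere X -> is_Hinfty Q ->
  exists s : quantum_group_structure T Q, acts_affinely (QuantumSubgroup s) X.
Proof.
move=> XP QP; have [xC _] := XP; have [uH _] := QP.
have /orthogonal_mxP[us ur uc] := umxP Q.
apply: (acts_of_relations QP XP).
- move=> i j k l p q ne eq1; rewrite !mxE tens_sum_mul3.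
  apply: big1 => a _; apply: big1 => b _; apply: big1 => c _.
  move: ne eq1; rewrite xpair_eqE.
  (* Exactly one of [i = p] and [j = q] holds. For [a <> c] the tensor leg carrying the shared index
     vanishes, for [a = c] the other leg does. *)
  have [ip|ip] := eqVneq i p; have [jq|jq] := eqVneq j q => //= _ _;
    have [ac|ac] := eqVneq a c.
  - by rewrite (uH a j) ?xpair_eqE ?ac ?eqxx // rmorph0 mulr0.
  - by rewrite (uH i a) ?xpair_eqE ?ip ?eqxx // rmorph0 mul0r.
  - by rewrite (uH i a) ?xpair_eqE ?ac ?eqxx ?andbT ?orbT // rmorph0 mul0r.
  - by rewrite (uH a j) ?xpair_eqE ?jq ?eqxx ?andbT ?orbT // rmorph0 mulr0.
- move=> i j k l p q; rewrite !mxE xpair_eqE.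
  have [<-|_] := eqVneq i j; last by rewrite !mul0r.
  have [<-|_] := eqVneq p q; last by rewrite mulr0.
  by rewrite andbb orbb => /negPf->.
- move=> i j k l p q ne eq1; have e := uH q p l k j i; rewrite -mulrA in e.
  rewrite !mxE; apply: e; last by rewrite (eq_sym q) (eq_sym p) orbC.
  by move: ne; rewrite !xpair_eqE (eq_sym q) (eq_sym p) andbC.
- move=> i j; rewrite tens_sum_sq => [|k l kl]; last first.
    by rewrite (Hinfty_mul0 us uH) ?eqxx // xpair_eqE eqxx.
  by apply: tens_sum_comm => // k l; apply: (Hinfty_central ur uH).
Qed.
End Coactions.

(** * Maximality *)

Lemma eqNr0 (R : realType) (A : cstarType R) (x : A) : x = - x -> x = 0.
Proof.
move=> /eqP; rewrite -addr_eq0 -mulr2n -scaler_nat scaler_eq0 pnatr_eq0 => /eqP.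
exact.
Qed.

Section Rigidity.
Variables (R : realType) (T : tensor_functor R) (N : nat).
Variables (G : quantum_subgroup T N) (X : sphere_subset R N).
Hypothesis GX : acts_affinely G X.
Local Notation u := (umx G).
Local Notation M n := (mx_cstar R n).

(** The antipode as an anti-multiplicative map of [G] to itself rather than into the opposite
    algebra. *)
Definition antip (x : G) : G := antipode (qstr G) x.

Lemma antipM x y : antip (x * y) = antip y * antip x.
Proof. exact: (rmorphM (antipode (qstr G)) x y). Qed.

Lemma antipB x y : antip (x - y) = antip x - antip y.
Proof. exact: (raddfB (antipode (qstr G)) x y). Qed.

Lemma antipN x : antip (- x) = - antip x.
Proof. exact: (raddfN (antipode (qstr G)) x). Qed.

Lemma antipE i j : antip (u i j) = u j i.
Proof. exact: antipodeE. Qed.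

Lemma model_transfer (P : sphere_relation R N) n tab S a0 w w' :
  sphere_defined_by P X -> involution_table n tab -> size S = size tab ->
  (0 < size S)%N -> uniq S -> P (M n) (model_coord R n tab S) ->
  size w = size w' -> \prod_(i <- w) coord X i = \prod_(i <- w') coord X i ->
  forall r s, (r <= n)%N -> (s <= n)%N ->
  word_sum u tab (nth a0 S) w r s = word_sum u tab (nth a0 S) w' r s.
Proof.
move=> [_ univ] tabP Stab S0 uS Pm sw ww'.
have [psi psiE] := univ _ _ (model_coords R tabP S0 Stab uS) Pm.
exact: (word_transfer GX a0 tabP S0 Stab uS psiE sw ww').
Qed.

(** The one-dimensional model is the classical point with equal coordinates on [S] and zero
    coordinates elsewhere. *)
Lemma real_transfer S a0 w w' : is_real_sphere X -> (0 < size S)%N -> uniq S ->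
  size w = size w' -> \prod_(i <- w) coord X i = \prod_(i <- w') coord X i ->
  word_sum u (nseq (size S) [:: 0%N]) (nth a0 S) w 0 0 =
  word_sum u (nseq (size S) [:: 0%N]) (nth a0 S) w' 0 0.
Proof.
move=> XP S0 uS sw ww'.
apply: (model_transfer a0 XP (n := 0)) => //; last 2 first.
- by rewrite size_nseq.
- by move=> i j; apply/matrixP => r s; rewrite [LHS]mxE [RHS]mxE !big_ord1 !ord1 mulrC.
apply/allP => l; rewrite mem_iota size_nseq /= => lS.
by rewrite /tab_fun !nth_nseq lS.
Qed.

Lemma half_transfer n tab S a0 w w' : is_half_liberated_sphere X ->
  involution_table n tab -> half_table n tab -> size S = size tab ->
  (0 < size S)%N -> uniq S ->
  size w = size w' -> \prod_(i <- w) coord X i = \prod_(i <- w') coord X i ->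
  forall r s, (r <= n)%N -> (s <= n)%N ->
  word_sum u tab (nth a0 S) w r s = word_sum u tab (nth a0 S) w' r s.
Proof.
move=> XP tabP tabH Stab S0 uS; apply: (model_transfer a0 XP) => // i j k.
rewrite /model_coord.
case: ifP => iS; last by rewrite !(mul0r, mulr0).
case: ifP => jS; last by rewrite !(mul0r, mulr0).
case: ifP => kS; last by rewrite !(mul0r, mulr0).
by rewrite -!scalerAl -!scalerAr -!scalerAl (tab_mx_half R tabP tabH) -?Stab ?index_mem.
Qed.

Lemma infinity_transfer n tab S a0 w w' : is_infinity_sphere X ->
  involution_table n tab -> size S = size tab -> (0 < size S)%N -> uniq S ->
  size w = size w' -> \prod_(i <- w) coord X i = \prod_(i <- w') coord X i ->
  forall r s, (r <= n)%N -> (s <= n)%N ->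
  word_sum u tab (nth a0 S) w r s = word_sum u tab (nth a0 S) w' r s.
Proof.
move=> XP tabP Stab S0 uS; apply: (model_transfer a0 XP) => // i j.
by rewrite model_coord_sq // -scalerAl -scalerAr mul1r mulr1.
Qed.

Lemma real_rigid : is_real_sphere X ->
  forall i j k l, u i j * u k l = u k l * u i j.
Proof.
move=> XP; have [xC _] := XP.
have C1 i j a : u i a * u j a = u j a * u i a.
  have := real_transfer (S := [:: a]) (w := [:: i; j]) (w' := [:: j; i]) a XP isT isT erefl.
  rewrite !big_cons !big_nil !mulr1 => /(_ (xC i j)).
  by rewrite /word_sum unlock /= !mulr1 !addr0.
pose D i a j b := u i a * u j b - u j b * u i a.
(* The point with two equal nonzero coordinates [a] and [b]; the terms with a repeated column cancel
   by [C1]. *)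
have C2 i j a b : D i a j b = - D i b j a.
  have [->|ab] := eqVneq a b; first by rewrite /D C1 subrr oppr0.
  have := real_transfer (S := [:: a; b]) (w := [:: i; j]) (w' := [:: j; i]) a XP.
  rewrite /= inE ab !big_cons !big_nil !mulr1 => /(_ isT isT erefl (xC i j)).
  rewrite /= !addr0 !mulrDr C1 [u i b * u j b]C1 -!addrA => /addrI.
  rewrite !addrA => /addIr e; apply/eqP.
  by rewrite /D opprB subr_eq addrAC eq_sym subr_eq e.
(* The antipode transposes indices and reverses products, so [C2] with rows and columns exchanged
   becomes symmetry in the columns. *)
have C2' i j a b : D i a j b = D i b j a.
  have := congr1 antip (C2 b a j i).
  by rewrite /D antipN !antipB !antipM !antipE => ->; rewrite opprB.
move=> i a j b; apply/subr0_eq.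
by apply: eqNr0; rewrite -/(D i a j b) {1}C2 C2'.
Qed.

(** The models use reflections of a cyclic group: a product of three reflections is again a
    reflection, hence its own inverse, which is $abc=cba$. *)
Lemma half_rigid : is_half_liberated_sphere X ->
  forall i j k l p q, u i j * u k l * u p q = u p q * u k l * u i j.
Proof.
move=> XP; have [xC _] := XP.
have coord_half i j k : \prod_(l <- [:: i; j; k]) coord X l = \prod_(l <- [:: k; j; i]) coord X l.
  by rewrite !big_cons !big_nil !mulr1 !mulrA.
have transfer tab n S a0 i j k tabP tabH St S0 uS := half_transfer (S := S)
  (n := n) (tab := tab) (w := [:: i; j; k]) (w' := [:: k; j; i]) a0 XP
  tabP tabH St S0 uS erefl (coord_half i j k).
have C1 i j k a : u i a * u j a * u k a = u k a * u j a * u i a.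
  have := transfer [:: [:: 0%N]] 0%N [:: a] a i j k isT isT erefl isT isT 0%N 0%N isT isT.
  by rewrite /word_sum unlock /= !mulr1 !addr0 !mulrA.
have C2 i j k a b : a != b ->
   u i a * u j b * u k a = u k a * u j b * u i a /\
   u i a * u j a * u k b + u i b * u j a * u k a =
   u k a * u j a * u i b + u k b * u j a * u i a.
  move=> ab.
  (* The reflections t |-> 1 - t and t |-> - t of Z/4: only aba sends 0 to 2,
     and only aab, baa and bbb fix 0. *)
  have tr := transfer [:: [:: 1; 0; 3; 2]; [:: 0; 3; 2; 1]]%N 3%N [:: a; b] a i j k
    isT isT erefl isT.
  rewrite [uniq _]/= inE ab in tr; split.
    have := tr isT 0%N 2%N isT isT.
    by rewrite /word_sum unlock /= !(mulr1, mulr0, addr0, add0r) !mulrA.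
  have := tr isT 0%N 0%N isT isT.
  rewrite /word_sum unlock /= !(mulr1, mulr0, addr0, add0r) !mulrDr !mulrA.
  by rewrite C1 !addrA => /addIr.
have C3 i j k a b c : a != b -> a != c -> b != c ->
    u i a * u j b * u k c + u i c * u j b * u k a =
    u k a * u j b * u i c + u k c * u j b * u i a.
  move=> ab ac bc.
  (* The reflections t |-> 1 - t, t |-> - t and t |-> 3 - t of Z/8: only abc and
     cba send 0 to 4. *)
  have tr := transfer [:: [:: 1; 0; 7; 6; 5; 4; 3; 2]; [:: 0; 7; 6; 5; 4; 3; 2; 1];
    [:: 3; 2; 1; 0; 7; 6; 5; 4]]%N 7%N [:: a; b; c] a i j k isT isT erefl isT.
  rewrite [uniq _]/= !inE negb_or ab ac bc in tr.
  have := tr isT 0%N 4%N isT isT.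
  by rewrite /word_sum unlock /= !(mulr1, mulr0, addr0, add0r) !mulrA.
pose D i a j b k c := u i a * u j b * u k c - u k c * u j b * u i a.
(* The commutator-like [D] changes sign when the outer columns [a] and [c] are exchanged; [C1], [C2]
   and [C3] cover all coincidences among [a], [b], [c]. *)
have C i j k a b c : D i a j b k c = - D i c j b k a.
  suff e : u i a * u j b * u k c + u i c * u j b * u k a =
           u k a * u j b * u i c + u k c * u j b * u i a.
    by apply/eqP; rewrite /D opprB subr_eq addrAC eq_sym subr_eq e.
  have [<-|ac] := eqVneq a c.
    have [<-|ab] := eqVneq a b; first by rewrite C1.
    by have [-> _] := C2 i j k a b ab.
  have [<-|ab] := eqVneq a b; first by have [] := C2 i j k a c ac.
  have [<-|bc] := eqVneq b c; last exact: C3.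
  by rewrite addrC [RHS]addrC; have [] := C2 i j k b a; rewrite 1?eq_sym.
have C' i j k a b c : D i a j b k c = D i c j b k a.
  have := congr1 antip (C c b a k j i).
  by rewrite /D antipN !antipB !antipM !antipE !mulrA => ->; rewrite opprB.
move=> i a j b k c; apply/subr0_eq.
by apply: eqNr0; rewrite -/(D i a j b k c) {1}C C'.
Qed.

(** * Rigidity for $S^{N-1}_{\mathbb R,\infty}$: central squares and vanishing products in a row *)

Section InfinityRigidity.
Hypothesis XP : is_infinity_sphere X.
Local Notation q i a := (u i a * u i a).

Lemma infinity_model n tab S a0 i j r s :
  involution_table n tab -> size S = size tab -> (0 < size S)%N -> uniq S ->
  (r <= n)%N -> (s <= n)%N ->
  word_sum u tab (nth a0 S) [:: i; i; j] r s = word_sum u tab (nth a0 S) [:: j; i; i] r s.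
Proof.
have [xC _] := XP; move=> tabP Stab S0 uS.
apply: (infinity_transfer a0 XP tabP Stab S0 uS) => //.
by rewrite !big_cons !big_nil !mulr1 mulrA -expr2 xC.
Qed.

Lemma infinity_exchange i j a b c : a != b -> b != c ->
  u i a * u i b * u j c = u j a * u i b * u i c.
Proof.
move=> ab bc; have [<-|ac] := eqVneq a c.
  (* a = (01)(23) and b = (12): only aba sends 0 to 3. *)
  have := @infinity_model 3 [:: [:: 1; 0; 3; 2]; [:: 0; 2; 1; 3]]%N [:: a; b] a i j 0 3.
  rewrite [uniq _]/= inE ab => /(_ isT erefl isT isT isT isT).
  by rewrite /word_sum unlock /= !(mulr1, mulr0, addr0, add0r) !mulrA.
(* a = (01), b = (12) and c = (23): only abc sends 0 to 3. *)
have := @infinity_model 3 [:: [:: 1; 0; 2; 3]; [:: 0; 2; 1; 3]; [:: 0; 1; 3; 2]]%N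
  [:: a; b; c] a i j 0 3.
rewrite [uniq _]/= !inE negb_or ab bc ac => /(_ isT erefl isT isT isT isT).
by rewrite /word_sum unlock /= !(mulr1, mulr0, addr0, add0r) !mulrA.
Qed.

Lemma infinity_sqC1 i j a : q i a * u j a = u j a * q i a.
Proof.
have := @infinity_model 0 [:: [:: 0]]%N [:: a] a i j 0 0 isT erefl isT isT isT isT.
by rewrite /word_sum unlock /= !(mulr1, addr0) !mulrA.
Qed.

Lemma infinity_sqC2 i j a c : a != c ->
  q i a * u j c - u j c * q i a = u j a * u i a * u i c - u i c * u i a * u j a.
Proof.
move=> ac.
(* a = (02)(13) and c = (01): only aac, caa and ccc send 0 to 1. *)
have := @infinity_model 3 [:: [:: 2; 3; 0; 1]; [:: 1; 0; 2; 3]]%N [:: a; c] a i j 0 1.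
rewrite [uniq _]/= inE ac => /(_ isT erefl isT isT isT isT).
rewrite /word_sum unlock /= !(mulr1, mulr0, addr0, add0r) !mulrDr !mulrA.
rewrite infinity_sqC1 !mulrA !addrA => /addIr e; apply/eqP.
by rewrite subr_eq addrAC eq_sym subr_eq e.
Qed.

Lemma infinity_sq_central i j a c : q i a * u j c = u j c * q i a.
Proof.
have [->|ac] := eqVneq a c; first exact: infinity_sqC1.
have [->|ij] := eqVneq i j.
  have := congr1 antip (infinity_sqC1 a c j).
  by rewrite !antipM !antipE.
(* With rows and columns exchanged, the antipode returns the same right-hand side as in
   [infinity_sqC2] but the opposite commutator, so the commutator equals its own negative. *)
have flip := congr1 antip (infinity_sqC2 a c ij).
apply/subr0_eq/eqNr0; rewrite {1}(infinity_sqC2 i j ac).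
by rewrite opprB; move: flip; rewrite !antipB !antipM !antipE !mulrA => ->.
Qed.

Lemma infinity_sqsqC i a j b : q i a * q j b = q j b * q i a.
Proof. by rewrite mulrA infinity_sq_central -mulrA infinity_sq_central mulrA. Qed.

(** The last bracket is the adjoint of the preceding word; the inner squares are central and can be
    pulled out one after another. *)
Lemma infinity_sandwich i a k b j c :
  u i a * u k b * u j c * (u j c * (u k b * u i a)) = q i a * q k b * q j c.
Proof.
transitivity (u i a * (u k b * q j c) * u k b * u i a); first by rewrite !mulrA.
rewrite -infinity_sq_central.
transitivity (u i a * q j c * q k b * u i a); first by rewrite !mulrA.
rewrite -infinity_sq_central.
transitivity (q j c * (u i a * q k b) * u i a); first by rewrite !mulrA.
rewrite -infinity_sq_central.
transitivity (q j c * (q k b * q i a)); first by rewrite !mulrA.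
rewrite (infinity_sqsqC k b) mulrA (infinity_sqsqC j c) -mulrA.
by rewrite (infinity_sqsqC j c) mulrA.
Qed.

(** The exchange relation multiplied by its adjoint. *)
Lemma infinity_sq_exchange i j a b c : a != b -> c != b ->
  q i a * q i b * q j c = q j a * q i b * q i c.
Proof.
move=> ab cb; have /orthogonal_mxP[us _ _] := umxP G.
rewrite -!infinity_sandwich; have bc : b != c by rewrite eq_sym.
have e1 := infinity_exchange i j ab bc.
have e2 : u j c * (u i b * u i a) = u i c * (u i b * u j a).
  by have := congr1 star e1; rewrite !starM !us.
by rewrite e2 e1.
Qed.

(** Sum [infinity_sq_exchange] over [j]; the columns of squares add up to 1. *)
Lemma infinity_sq_flat i a b c : a != b -> c != b -> q i b * q i a = q i b * q i c.
Proof.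
move=> ab cb; have /orthogonal_mxP[_ _ uc] := umxP G.
have : \sum_j q i a * q i b * q j c = \sum_j q j a * q i b * q i c.
  by apply: eq_bigr => j _; apply: infinity_sq_exchange.
rewrite -mulr_sumr -!mulr_suml !uc !eqxx mulr1 mul1r => <-.
exact: infinity_sqsqC.
Qed.

Lemma infinity_row_mul0 i a b : (2 < N)%N -> a != b -> u i a * u i b = 0.
Proof.
move=> N3 ab; have /orthogonal_mxP[us ur uc] := umxP G.
have third x y : exists2 z : 'I_N, z != x & z != y.
  suff /existsP[z /andP[]] : [exists z : 'I_N, (z != x) && (z != y)] by exists z.
  apply: contraLR N3; rewrite negb_exists => /forallP xy.
  rewrite -leqNgt -[N]card_ord (leq_trans _ (_ : #|[set x; y]| <= 2)%N) //; last first.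
    by rewrite cards2; case: eqP.
  apply/subset_leq_card/fintype.subsetP => z _; rewrite !inE.
  by have := xy z; rewrite negb_and !negbK.
have ba : b != a by rewrite eq_sym.
pose E := q i a * q i b.
have EabA j x : x != b -> E * q j x = E * q j a.
  move=> xb; rewrite /E (infinity_sq_exchange i j ab xb) -mulrA -(infinity_sq_flat i ab xb).
  by rewrite [LHS]mulrA (infinity_sq_exchange i j ab ab).
have EabB j x : x != a -> E * q j x = E * q j b.
  move=> xa; rewrite /E (infinity_sqsqC i a) (infinity_sq_exchange i j ba xa) -mulrA.
  by rewrite -(infinity_sq_flat i ba xa) [LHS]mulrA (infinity_sq_exchange i j ba ba).
have Econst j x y : E * q j x = E * q j y.
  suff Ea z : E * q j z = E * q j a by rewrite !Ea.
  have [zb|] := eqVneq z b; last exact: EabA.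
  have [c ca cb] := third a b.
  by rewrite zb -(EabB j c ca) EabA.
have sum_q j : \sum_x q j x = 1 by rewrite ur eqxx.
(* By [Econst] the product [E * q j y] does not depend on [y], and these products sum to [E]; so the
   factor [q j y] can be cancelled next to [E]. *)
have cancel j y w w' : E * q j y * w = E * q j y * w' -> E * w = E * w'.
  move=> e; rewrite -[E]mulr1 -(sum_q j) mulr_sumr !mulr_suml.
  by apply: eq_bigr => x _; rewrite (Econst j x y).
(* After multiplication by [q j y], the exchange relation applies to $u_{ix}u_{ib'}u_{jy}$. In the
   result the left side is free of [y] and the right side is free of [x]. *)
have Ek j x y b' : x != b' -> y != b' ->
    E * (u j x * u i x * u i b') = E * (u i b' * (u i y * u j y)).
  move=> xb yb; apply: (cancel j y).
  rewrite [in RHS](Econst j y x) -[LHS]mulrA -[RHS]mulrA; congr (E * _).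
  have qW : GRing.comm (q j y) (u j x * u i x * u i b').
    by do 2?[apply: commrM]; apply: infinity_sq_central.
  rewrite qW; have b'y : b' != y by rewrite eq_sym.
  transitivity (u j x * (u i x * u i b' * u j y) * u j y); first by rewrite !mulrA.
  by rewrite (infinity_exchange i j xb b'y) !mulrA.
(* A third index [b'] makes [Ek] available for both [x] and [y] with the same right-hand side; the
   extra factor $u_{ib'}^2$ is then cancelled. *)
have Eh j x y : E * (u j x * u i x) = E * (u j y * u i y).
  have [b' b'x b'y] := third x y; rewrite ![b' == _]eq_sym in b'x b'y.
  apply: (cancel i b').
  have qW z : E * q i b' * (u j z * u i z) = E * (u j z * u i z * u i b') * u i b'.
    rewrite -[LHS]mulrA -[RHS]mulrA; congr (E * _).
    have -> : q i b' * (u j z * u i z) = u j z * u i z * q i b'.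
      by apply: commrM; apply: infinity_sq_central.
    by rewrite !mulrA.
  by rewrite !qW (Ek j x x) // (Ek j y x).
have [j ji _] := third i i.
have hsum : \sum_x u j x * u i x = 0 by rewrite ur (negPf ji).
have Eh0 : E * (u j a * u i a) = 0.
  have : (E * (u j a * u i a)) *+ N = 0.
    transitivity (\sum_(x < N) E * (u j a * u i a)); first by rewrite sumr_const card_ord.
    transitivity (E * \sum_x u j x * u i x); last by rewrite hsum mulr0.
    by rewrite mulr_sumr; apply: eq_bigr => x _; apply: Eh.
  move/eqP; rewrite -scaler_nat scaler_eq0 pnatr_eq0 => /orP[/eqP N0|/eqP //].
  by rewrite N0 in N3.
(* Multiplying [Eh0] by $u_{ia}u_{ja}$ gives [E * q j a * q i a = 0], and two cancellations remove
   the squares. *)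
have E0 : E = 0.
  have : E * q j a * q i a = 0.
    rewrite -mulrA; transitivity (E * (u j a * u i a) * (u i a * u j a)).
      rewrite -[RHS]mulrA; congr (E * _).
      transitivity (u j a * (q i a * u j a)); last by rewrite !mulrA.
      by rewrite infinity_sq_central !mulrA.
    by rewrite Eh0 mul0r.
  rewrite -[in RHS](mulr0 (E * q j a)) => /cancel; rewrite mulr0 => e.
  rewrite -[E]mulr1 -(mulr0 E); apply: (cancel i a).
  by rewrite e !mul0r.
apply: cstar_eq0; rewrite starM !us.
have -> : u i b * u i a * (u i a * u i b) = u i b * q i a * u i b by rewrite !mulrA.
by rewrite -infinity_sq_central -mulrA.
Qed.

End InfinityRigidity.
End Rigidity.

Lemma infinity_rigid (R : realType) (T : tensor_functor R) (N : nat)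
    (G : quantum_subgroup T N) (X : sphere_subset R N) :
  (0 < N)%N -> N <> 2%N -> acts_affinely G X -> is_infinity_sphere X ->
  forall i j k l p q, (i, j) != (p, q) -> (i == p) || (j == q) ->
    umx G i j * umx G k l * umx G p q = 0.
Proof.
move=> N0 N2 GX XP i j k l p q ne eq1.
have N3 : (2 < N)%N.
  rewrite ltn_neqAle eq_sym; apply/andP; split; first exact/eqP.
  (* For [N = 1] all indices coincide, contradicting [ne]. *)
  rewrite ltn_neqAle N0 andbT; apply: contra ne => /eqP N1.
  have all_eq (x y : 'I_N) : x = y.
    by apply: val_inj; case: x y => x xN [y yN] /=; lia.
  by rewrite (all_eq i p) (all_eq j q).
have row0 := infinity_row_mul0 GX XP _ N3.
have col0 a b x : a != b -> umx G b x * umx G a x = 0.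
  move=> ab; have := congr1 (@antip _ _ _ G) (row0 x a b ab).
  by rewrite antipM !antipE => ->; exact: (raddf0 (antipode (qstr G))).
have mul0 : umx G i j * umx G p q = 0.
  case/orP: eq1 ne => /eqP<-; rewrite xpair_eqE eqxx ?andbT => /= ne; first exact: row0.
  by apply: col0; rewrite eq_sym.
have /orthogonal_mxP[_ ur _] := umxP G.
(* Since row products vanish, $u_{ij}=u_{ij}^3$. Moving the central square past $u_{kl}$ puts
   $u_{ij}$ next to $u_{pq}$. *)
have cube : umx G i j = umx G i j * (umx G i j * umx G i j).
  have sum1 : 1 = \sum_b umx G i b * umx G i b by rewrite ur eqxx.
  rewrite -[LHS]mulr1 sum1 mulr_sumr (bigD1 j) //= big1 ?addr0 // => b bj.
  by rewrite mulrA row0 ?mul0r // eq_sym.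
rewrite cube -(mulrA _ _ (umx G k l)) (infinity_sq_central GX XP).
by rewrite -!mulrA mul0 !mulr0.
Qed.

(** * Inclusions *)

Lemma not_Ostar_sub_Hinfty (R : realType) (N : nat) (Q Q' : oplus_subset R N) :
  (2 < N)%N -> is_Ostar Q -> is_Hinfty Q' -> ~ oplus_sub Q Q'.
Proof.
move=> N3 [_ univ] [uH _] [f fE].
pose a := Ordinal (ltnW (ltnW N3)); pose b := Ordinal (ltnW N3); pose c := Ordinal N3.
(* The reflection in the hyperplane orthogonal to (1, ..., 1). *)
pose v : 'M[R[i]^o]_N := \matrix_(i, j) ((i == j)%:R - 2 / N%:R).
have N0 : N%:R != 0 :> R[i] by rewrite pnatr_eq0 -lt0n (ltn_trans _ N3).
have delta_sum j (F : 'I_N -> R[i]) : \sum_k (j == k)%:R * F k = F j.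
  rewrite (bigD1 j) //= eqxx mul1r big1 ?addr0 // => k kj.
  by rewrite eq_sym (negPf kj) mul0r.
have vv i j : \sum_k v i k * v j k = (i == j)%:R.
  under eq_bigr => k _ do rewrite !mxE mulrBl.
  rewrite sumrB delta_sum -mulr_sumr sumrB sumr_const card_ord -[2 / N%:R *+ N]mulr_natr.
  rewrite divfK //; under [X in _ * (X - _)]eq_bigr => k _ do rewrite -[_%:R]mulr1.
  by rewrite delta_sum eq_sym; ring.
have [g gE] : exists g : starMorphism Q R[i]^o, forall i j, g (umx Q i j) = v i j.
  apply: univ; last by move=> i j k l p q; rewrite mulrC mulrA mulrAC.
  apply/orthogonal_mxP; split=> // [i j|i j].
    by rewrite mxE; apply: conj_Creal; rewrite rpredB ?rpred_div ?rpred_nat.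
  by rewrite -vv; apply: eq_bigr => k _; rewrite !mxE (eq_sym k i) (eq_sym k j).
have /(congr1 g) : umx Q a b * umx Q a b * umx Q a c = 0.
  by rewrite -!fE -!rmorphM uH ?rmorph0.
rewrite !rmorphM rmorph0 /= !gE !mxE /= !sub0r.
move/eqP; rewrite !mulf_eq0 !oppr_eq0 !mulf_eq0 !invr_eq0 (negPf N0).
by rewrite (pnatr_eq0 R[i] 2).
Qed.

(** A diagonal matrix of arbitrary self-adjoint involutions satisfies the relations of
    $H_N^{[\infty]}$; three involutions with $abc\ne cba$ then exclude $O_N^*$. *)
Lemma not_Hinfty_sub_Ostar (R : realType) (N : nat) (Q Q' : oplus_subset R N) :
  (2 < N)%N -> is_Ostar Q -> is_Hinfty Q' -> ~ oplus_sub Q' Q.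
Proof.
move=> N3 [uC _] [_ univ] [f fE].
pose a := Ordinal (ltnW (ltnW N3)); pose b := Ordinal (ltnW N3); pose c := Ordinal N3.
(* The transpositions (01), (12), (23), and the identity for the remaining indices, to which [index]
   assigns position 3. *)
pose tab := [:: [:: 1; 0; 2; 3]; [:: 0; 2; 1; 3]; [:: 0; 1; 3; 2]; [:: 0; 1; 2; 3]]%N.
have tabP : involution_table 3 tab by [].
pose s i : mx_cstar R 3 := tab_mx R 3 tab (index i [:: a; b; c]).
have idx i : (index i [:: a; b; c] < size tab)%N by rewrite ltnS index_size.
pose v : 'M[mx_cstar R 3]_N := \matrix_(i, j) if i == j then s i else 0.
have [g gE] : exists g : starMorphism Q' (mx_cstar R 3), forall i j, g (umx Q' i j) = v i j.
  apply: univ.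
    apply/orthogonal_mxP; split=> i j.
    - by rewrite mxE; case: eqP => _; rewrite ?star0 ?tab_mx_star.
    - rewrite (bigD1 i) //= big1 => [|k ki]; rewrite !mxE ?eqxx ?addr0.
        by rewrite eq_sym; case: eqP => [->|_]; rewrite ?tab_mx_sq ?mulr0.
      by rewrite eq_sym (negPf ki) mul0r.
    - rewrite (bigD1 i) //= big1 => [|k ki]; rewrite !mxE ?eqxx ?addr0.
        by case: eqP => [->|_]; rewrite ?tab_mx_sq ?mulr0.
      by rewrite (negPf ki) mul0r.
  move=> i j k l p q; rewrite xpair_eqE !mxE.
  have [<-|_] := eqVneq i j; last by rewrite !mul0r.
  have [<-|_] := eqVneq p q; last by rewrite mulr0.
  by rewrite andbb orbb => /negPf->.
have /(congr1 g) : umx Q' a a * umx Q' b b * umx Q' c c =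
    umx Q' c c * umx Q' b b * umx Q' a a.
  by rewrite -!fE -!rmorphM uC.
(* With the first letter acting first, [abc] sends 0 to 3 while [cba] sends 0 to 1, so the entries
   at [(0, 3)] are 1 and 0. *)
rewrite !rmorphM /= !gE !mxE !eqxx -!mulrA => /matrixP/(_ ord0 ord_max).
rewrite !tab_mx_mulE // !mxE !inordK //=.
move/eqP; by rewrite oner_eq0.
Qed.

Theorem proposition5p2 (R : realType) (T : tensor_functor R) (N : nat)
    (hN : (0 < N)%N) :
  [/\ forall X : sphere_subset R N,
        is_monomial_sphere (Z2pow_urg N) X <-> is_real_sphere X,
      forall X : sphere_subset R N,
        is_monomial_sphere (Z2half_urg N) X <-> is_half_liberated_sphere X,
      forall X : sphere_subset R N,
        is_monomial_sphere (Z2free_urg N) X <-> is_infinity_sphere X,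
      forall X Y : sphere_subset R N,
        is_real_sphere X -> is_half_liberated_sphere Y -> sphere_sub X Y
    & forall X Y : sphere_subset R N,
        is_half_liberated_sphere X -> is_infinity_sphere Y -> sphere_sub X Y]
  /\
  [/\ forall (X : sphere_subset R N) (Q : oplus_subset R N),
        is_real_sphere X -> is_O Q -> is_affine_isometry_group T X Q,
      forall (X : sphere_subset R N) (Q : oplus_subset R N),
        is_half_liberated_sphere X -> is_Ostar Q ->
        is_affine_isometry_group T X Q
    & N <> 2%N ->
      forall (X : sphere_subset R N) (Q : oplus_subset R N),
        is_infinity_sphere X -> is_Hinfty Q -> is_affine_isometry_group T X Q]
  /\
  (forall Q Q' : oplus_subset R N, is_O Q -> is_Ostar Q' -> oplus_sub Q Q')
  /\
  ((2 < N)%N ->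
   forall Q Q' : oplus_subset R N, is_Ostar Q -> is_Hinfty Q' ->
     ~ oplus_sub Q Q' /\ ~ oplus_sub Q' Q).
Proof.
have P_O : forall (X : sphere_subset R N) (Q : oplus_subset R N),
    is_real_sphere X -> is_O Q -> is_affine_isometry_group T X Q.
  move=> X Q XP QP; split=> [|G GX]; first exact: real_action.
  by have [_ univ] := QP; apply: univ (umxP G) (real_rigid GX XP).
have P_Ostar : forall (X : sphere_subset R N) (Q : oplus_subset R N),
    is_half_liberated_sphere X -> is_Ostar Q ->
    is_affine_isometry_group T X Q.
  move=> X Q XP QP; split=> [|G GX]; first exact: half_action.
  by have [_ univ] := QP; apply: univ (umxP G) (half_rigid GX XP).
have P_Hinfty : N <> 2%N -> forall (X : sphere_subset R N) (Q : oplus_subset R N),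
    is_infinity_sphere X -> is_Hinfty Q ->
    is_affine_isometry_group T X Q.
  move=> N2 X Q XP QP; split=> [|G GX]; first exact: infinity_action.
  by have [_ univ] := QP; apply: univ (umxP G) (infinity_rigid hN N2 GX XP).
split; [split | split; [split | split]] => //.
- exact: monomial_pow.
- exact: monomial_half.
- exact: monomial_free.
- move=> X Y [xC _] [_ univ]; apply: univ (coordP X) _ => i j k.
  by rewrite (xC i) -mulrA (xC i k) mulrA (xC j).
- move=> X Y [xC _] [_ univ]; apply: univ (coordP X) _ => i j.
  by rewrite expr2 xC mulrA.
- move=> Q Q' [uC _] [_ univ]; apply: univ (umxP Q) _ => i j k l p q.
  by rewrite (uC i j) -mulrA (uC i j p q) mulrA (uC k l).
- move=> N3 Q Q' QP Q'P; split.
  + exact: not_Ostar_sub_Hinfty.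
  + exact: not_Hinfty_sub_Ostar.
Qed.
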